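(* Let $r\geq 3$ be an integer. There exists $n_0=n_0(r)$ such that for every $n\geq n_0$ and every $K_r$-minor free graph $G$ on $n$ vertices, \[ s(G)\leq\sqrt{4(r-2)(n-r+2)+(r-3)^2}, \] with equality if and only if $G\cong K_{r-2}\vee(n-r+2)K_1$.
   Context: For a simple graph $G$, $\lambda_1(G)\geq\cdots\geq\lambda_n(G)$ are the eigenvalues of its adjacency matrix and the spread is $s(G)=\lambda_1(G)-\lambda_n(G)$. A graph is $H$-minor free if $H$ cannot be obtained from it by vertex deletions, edge deletions and edge contractions. $G\vee H$ denotes the join (disjoint union plus all edges between the two graphs), $K_m$ is the complete graph and $mK_1$ the edgeless graph on $m$ vertices. *)

(* Defs.v *)
From HB Require Import structures.
From mathcomp Require Import all_boot all_order all_algebra.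
From mathcomp Require Import polyrcf.
From mathcomp Require Import reals.
Set Implicit Arguments. Unset Strict Implicit. Unset Printing Implicit Defensive.
Import Order.TTheory GRing.Theory Num.Theory.
Local Open Scope ring_scope.

Definition simple_graph (T : finType) (e : rel T) : Prop :=
  symmetric e /\ irreflexive e.

Definition del_vertex (T : finType) (e : rel T) (v : T) : rel {x : T | x != v} :=
  fun x y => e (val x) (val y).
Arguments del_vertex {T} e v.

Definition del_edge (T : finType) (e : rel T) (u v : T) : rel T :=
  fun x y => e x y && ~~ (((x == u) && (y == v)) || ((x == v) && (y == u))).

(* contract the edge uv: v is merged into u, which becomes adjacent to
   N(u) \cup N(v) minus {u, v} *)
Definition contract (T : finType) (e : rel T) (u v : T) : rel {x : T | x != v} :=
  fun x y => [|| e (val x) (val y),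
                 (val x == u) && e v (val y) && (val y != u)
               | (val y == u) && e (val x) v && (val x != u)].
Arguments contract {T} e u v.

Inductive minor_step : forall (T : finType), rel T -> forall (U : finType), rel U -> Prop :=
| ms_del_vertex (T : finType) (e : rel T) (v : T) :
    minor_step e (del_vertex e v)
| ms_del_edge (T : finType) (e : rel T) (u v : T) :
    minor_step e (del_edge e u v)
| ms_contract (T : finType) (e : rel T) (u v : T) :
    e u v -> minor_step e (contract e u v)
| ms_iso (T U : finType) (e : rel T) (f : rel U) (h : T -> U) :
    bijective h -> (forall x y, f (h x) (h y) = e x y) -> minor_step e f.

Inductive is_minor (U : finType) (f : rel U) : forall (T : finType), rel T -> Prop :=
| minor_refl : is_minor f f
| minor_trans (T T' : finType) (e : rel T) (e' : rel T') :
    minor_step e e' -> is_minor f e' -> is_minor f e.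

Definition complete_graph (m : nat) : rel 'I_m := fun x y => x != y.

Definition empty_graph (m : nat) : rel 'I_m := fun _ _ => false.

Definition graph_join (T U : finType) (e : rel T) (f : rel U) : rel (T + U)%type :=
  fun x y => match x, y with
             | inl a, inl b => e a b
             | inr a, inr b => f a b
             | _, _ => true
             end.

Definition graph_iso (T U : finType) (e : rel T) (f : rel U) : Prop :=
  exists h : T -> U, bijective h /\ forall x y, f (h x) (h y) = e x y.

Definition adjmx (R : nzRingType) (n : nat) (e : rel 'I_n) : 'M[R]_n :=
  \matrix_(i, j) (e i j)%:R.

(* the sorted list of distinct (real) eigenvalues of a square real matrix *)
Definition eigenvalues (R : rcfType) (n : nat) (A : 'M[R]_n) : seq R :=
  rootsR (char_poly A).

Definition lambda_max (R : rcfType) (n : nat) (A : 'M[R]_n) : R :=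
  last 0 (eigenvalues A).
Definition lambda_min (R : rcfType) (n : nat) (A : 'M[R]_n) : R :=
  head 0 (eigenvalues A).
Definition spread (R : rcfType) (n : nat) (e : rel 'I_n) : R :=
  lambda_max (adjmx R e) - lambda_min (adjmx R e).

Arguments complete_graph m : clear implicits.
Arguments empty_graph m : clear implicits.
Arguments adjmx R {n} e.
Arguments spread R {n} e.
Arguments eigenvalues {R n} A.
Arguments lambda_max {R n} A.
Arguments lambda_min {R n} A.

(* Main.v *)
(** Let [s = r - 2] and let [d] be the average degree of the graph induced on a set [L] of [s]
    vertices. If an eigenvalue [lam] satisfies [lam ^ 2 >= s (n - s)], counting walks of length
    two through the large entries of its eigenvector, with linear edge bounds for minor-free
    graphs, produces [s] vertices [L] adjacent to almost all others. Excluding the minor makes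
    the common neighbourhood [B] of [L] independent, and each vertex of the small remainder [C]
    has at most one neighbour in [B].

    For such a graph and [t = d / 2], the quadratic form inequality
    [|(A - t) x| ^ 2 <= (s (n - s) + (s - 1) ^ 2 / 4) |x| ^ 2] holds, strictly for [x <> 0]
    unless [C] is empty and [L] is a clique. So every eigenvalue lies within
    [sqrt (s (n - s) + (s - 1) ^ 2 / 4)] of [t], half the claimed bound on the spread. *)
Require Import Defs.
From HB Require Import structures.
From mathcomp Require Import all_boot all_order all_algebra.
From mathcomp Require Import zify ring lra.
From mathcomp Require Import polyrcf.
From mathcomp Require Import reals.
Set Implicit Arguments. Unset Strict Implicit. Unset Printing Implicit Defensive.
Import Order.TTheory GRing.Theory Num.Theory.
Implicit Types T U : finType.

(** * Clique models and minors *)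

(** Write [rho ^ 2 = s (n - s) + (s - 1) ^ 2 / 4]. If the spread reaches [2 rho], one of the two
    extreme eigenvalues has modulus at least [rho], and nothing tells which. The structure must
    therefore come from an eigenvector whose eigenvalue has unknown sign: its absolute values
    satisfy only an inequality, and walk counting asks for no more.

    In the quadratic form the leading terms of order [s n] cancel exactly, so lower-order terms
    decide. The dangerous one couples the rows of [L] with the sum of [x] over [B]: it is twice that
    sum times the sum of [(deg l - 2 t) x_l] over [L]. Taking [2 t] to be the average degree makes
    these coefficients sum to zero, so only deviations of [x] on [L] from their mean enter, and the
    price is the variance of the degrees inside [L]. De Caen's bound keeps this variance below its
    critical value by a margin of order [1 / s ^ 2] when [L] is not a clique. Vertices of [C] are
    affordable because each of them misses a vertex of [L]. For a clique [L] with [C] empty,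
    [t = (s - 1) / 2] is the midpoint of the extreme eigenvalues [t + rho] and [t - rho]. *)

Definition adjacent T (e : rel T) (X Y : {set T}) : bool :=
  [exists x in X, [exists y in Y, e x y]].

(* Connectedness in terms of cuts, which transfer to images and unions without handling paths. *)
Definition cut_connected T (e : rel T) (A : {set T}) : bool :=
  [forall X : {set T}, [&& X \subset A, X != set0 & X != A] ==> adjacent e X (A :\: X)].

Definition separate T (e : rel T) (X Y : {set T}) : bool :=
  [disjoint X & Y] && adjacent e X Y.

(** The branch sets of a [K_r] minor, kept in a list so that taking a prefix or prepending one more
    branch set is immediate. *)
Definition clique_model T (e : rel T) (r : nat) : Prop :=
  exists Bs : seq {set T},
    [/\ size Bs = r, all (fun X => (X != set0) && cut_connected e X) Bs
      & pairwise (separate e) Bs].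

Lemma adjacentP T (e : rel T) (X Y : {set T}) :
  reflect (exists x y, [/\ x \in X, y \in Y & e x y]) (adjacent e X Y).
Proof.
apply: (iffP exists_inP) => [[x Xx /exists_inP[y Yy exy]]|[x [y [Xx Yy exy]]]].
  by exists x, y.
by exists x => //; apply/exists_inP; exists y.
Qed.

Lemma cut_connectedP T (e : rel T) (A : {set T}) :
  reflect (forall X : {set T}, X \subset A -> X != set0 -> X != A ->
             exists x y, [/\ x \in X, y \in A :\: X & e x y])
          (cut_connected e A).
Proof.
apply: (iffP forallP) => [H X sXA X0 XA|H X].
  by apply/adjacentP; apply: (implyP (H X)); rewrite sXA X0.
by apply/implyP => /and3P[sXA X0 XA]; apply/adjacentP/H.
Qed.

Lemma cut_connected1 T (e : rel T) (x : T) : cut_connected e [set x].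
Proof.
apply/cut_connectedP => X; rewrite subset1 => /orP[/eqP->|/eqP->]; by rewrite eqxx.
Qed.

Lemma cut_connected2 T (e : rel T) (x y : T) :
  symmetric e -> e x y -> cut_connected e [set x; y].
Proof.
move=> se exy; apply/cut_connectedP => X sX /set0Pn[z Xz] XA.
have [Xx|Xx] := boolP (x \in X); have [Xy|Xy] := boolP (y \in X).
- case/eqP: XA; apply/eqP; rewrite eqEsubset sX /=.
  by apply/subsetP => w; rewrite !inE => /orP[]/eqP->.
- by exists x, y; rewrite !inE Xx Xy eqxx orbT.
- by exists y, x; rewrite !inE Xx Xy eqxx /= se.
- by move: (subsetP sX _ Xz); rewrite !inE => /orP[]/eqP zE; rewrite zE (negPf Xx, negPf Xy) in Xz *.
Qed.

(** A cut of the image pulls back to a cut of [A], and an edge across it has distinct images. The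
    premise [h x != h y] leaves room for maps that collapse an edge, as a contraction does. *)
Lemma cut_connected_imset T U (e : rel T) (f : rel U) (h : T -> U) (A : {set T}) :
  (forall x y, e x y -> h x != h y -> f (h x) (h y)) ->
  cut_connected e A -> cut_connected f (h @: A).
Proof.
move=> hE /cut_connectedP cA; apply/cut_connectedP => Y sY /set0Pn[z Yz] YA.
have [x xA zE] := imsetP (subsetP sY _ Yz).
have [||] := cA (A :&: h @^-1: Y) (subsetIl _ _).
- by apply/set0Pn; exists x; rewrite !inE xA -zE.
- apply: contra YA => /eqP AE; rewrite eqEsubset sY; apply/subsetP => w /imsetP[a aA ->].
  by move: aA; rewrite -{1}AE !inE => /andP[].
move=> a [b []]; rewrite !inE => /andP[aA aY] /andP[]; rewrite negb_and orbC.
move=> /orP[bY|/negPf-> //] bA eab; exists (h a), (h b).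
split=> //; first by rewrite !inE bY imset_f.
by apply: hE => //; apply: contraNneq bY => <-.
Qed.

(** If a cut splits some [psi u], connectedness of that set gives the crossing edge. Otherwise the
    cut is a union of whole sets [psi u], hence comes from a cut of [A] in [f]. *)
Lemma cut_connected_bigcup T U (e : rel T) (f : rel U) (psi : U -> {set T}) (A : {set U}) :
  (forall u, psi u != set0) -> (forall u, cut_connected e (psi u)) ->
  (forall u v, f u v -> adjacent e (psi u) (psi v)) ->
  cut_connected f A -> cut_connected e (\bigcup_(u in A) psi u).
Proof.
move=> psi0 psic psia /cut_connectedP cA; apply/cut_connectedP => X sX /set0Pn[z Xz] XA.
have subX u : u \in A -> psi u \subset \bigcup_(u in A) psi u by move=> uA; apply: bigcup_sup.
have [/existsP[u /and3P[uA i0 iS]]|/existsPn noS] :=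
  boolP [exists u, [&& u \in A, psi u :&: X != set0 & ~~ (psi u \subset X)]].
  have [//||a [b [aX bX eab]]] := cut_connectedP _ _ (psic u) (psi u :&: X) (subsetIl _ _).
    by apply: contra iS => /eqP/setIidPl.
  exists a, b; move: aX bX; rewrite !inE => /andP[_ ->] /andP[].
  rewrite negb_and => /orP[/negPf-> //|->] bu; split=> //=.
  by apply: (subsetP (subX _ uA)).
have full u : u \in A -> psi u :&: X != set0 -> psi u \subset X.
  by move=> uA i0; move: (noS u); rewrite uA i0 /= negbK.
pose Y := [set u in A | psi u \subset X].
have sYA : Y \subset A by apply/subsetP => u; rewrite inE => /andP[].
have [||u [v [uY vY fuv]]] := cA Y sYA.
- have /bigcupP[u uA zu] := subsetP sX _ Xz.
  apply/set0Pn; exists u; rewrite inE uA full //.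
  by apply/set0Pn; exists z; rewrite inE zu.
- apply: contra XA => /eqP YE; rewrite eqEsubset sX; apply/bigcupsP => u.
  by rewrite -{1}YE inE => /andP[].
have /adjacentP[a [b [au bv eab]]] := psia _ _ fuv.
move: uY vY; rewrite !inE => /andP[uA uX] /andP[]; rewrite negb_and => /orP[/negPf-> //|vX] vA.
exists a, b; split=> //; first exact: (subsetP uX).
rewrite inE (subsetP (subX _ vA)) // andbT.
by apply: contra vX => bX; apply: full => //; apply/set0Pn; exists b; rewrite inE bv.
Qed.

(** Composition of minor models: [psi u] is the set of vertices represented by [u]. Singletons give
    the case of subgraphs, and one pair among singletons gives a contraction. *)
Lemma clique_model_pullback T U (e : rel T) (f : rel U) (psi : U -> {set T}) (r : nat) :
  (forall u, psi u != set0) -> (forall u, cut_connected e (psi u)) ->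
  (forall u v, u != v -> [disjoint psi u & psi v]) ->
  (forall u v, f u v -> adjacent e (psi u) (psi v)) ->
  clique_model f r -> clique_model e r.
Proof.
move=> psi0 psic psid psia [Bs [sz /allP aB pB]].
exists [seq \bigcup_(u in B) psi u | B : {set U} <- Bs]; split; first by rewrite size_map.
  apply/allP => _ /mapP[B BBs ->]; have /andP[/set0Pn[u uB] cB] := aB _ BBs.
  rewrite (cut_connected_bigcup psi0 psic psia cB) andbT.
  have /set0Pn[x xu] := psi0 u.
  by apply/set0Pn; exists x; apply/bigcupP; exists u.
rewrite pairwise_map; apply: sub_pairwise pB => X Y /andP[dXY /adjacentP[u [v [uX vY fuv]]]].
apply/andP; split; last first.
  have /adjacentP[x [y [xu yv exy]]] := psia _ _ fuv.
  by apply/adjacentP; exists x, y; split=> //; apply/bigcupP; [exists u|exists v].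
rewrite -setI_eq0; apply/set0Pn => -[x]; rewrite inE.
move=> /andP[/bigcupP[a aX xa] /bigcupP[b bY xb]].
have [ab|ab] := eqVneq a b.
  by move/disjointFr: dXY => /(_ _ aX); rewrite ab bY.
by move/disjointFr: (psid _ _ ab) => /(_ _ xa); rewrite xb.
Qed.

Lemma clique_model_inj T U (e : rel T) (f : rel U) (h : U -> T) (r : nat) :
  injective h -> (forall u v, f u v -> e (h u) (h v)) ->
  clique_model f r -> clique_model e r.
Proof.
move=> hI hE; apply: (@clique_model_pullback _ _ e f (fun u => [set h u])).
- by move=> u; apply/set0Pn; exists (h u); rewrite inE.
- by move=> u; apply: cut_connected1.
- by move=> u v uv; rewrite disjoints1 inE (inj_eq hI).
- by move=> u v fuv; apply/adjacentP; exists (h u), (h v); rewrite !inE !eqxx hE.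
Qed.

Lemma contract_simple T (e : rel T) (u v : T) :
  simple_graph e -> simple_graph (contract e u v).
Proof.
move=> [se ie]; split=> [x y|x]; rewrite /contract.
  rewrite (se (val y) (val x)) (se v (val x)) (se (val y) v).
  by congr (_ || _); rewrite orbC.
by rewrite ie /=; case: eqP => //= _; rewrite ?andbF.
Qed.

(** The quotient map of the contraction: [insubd] falls back on its default exactly at [v], which is
    thereby sent to [u]. *)
Definition merge_vertex T (u v : T) (uv : u != v) (x : T) : {x : T | x != v} :=
  insubd (Sub u uv) x.

Lemma val_merge T (u v : T) (uv : u != v) (x : T) :
  val (merge_vertex uv x) = if x == v then u else x.
Proof. by rewrite /merge_vertex val_insubd /=; case: eqP. Qed.

Lemma contract_merge T (e : rel T) (u v : T) (uv : u != v) (x y : T) :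
  e x y -> merge_vertex uv x != merge_vertex uv y ->
  contract e u v (merge_vertex uv x) (merge_vertex uv y).
Proof.
move=> exy; rewrite -val_eqE /contract !val_merge.
have [xv|xv] := eqVneq x v; have [yv|yv] := eqVneq y v; rewrite ?eqxx //=.
- by move=> uy; rewrite -xv exy eq_sym uy orbT.
- by move=> xu; rewrite -yv exy xu !orbT.
- by rewrite exy.
Qed.

Lemma clique_model_contract T (e : rel T) (u v : T) (r : nat) :
  symmetric e -> e u v -> u != v ->
  clique_model (contract e u v) r -> clique_model e r.
Proof.
move=> se euv uv.
pose psi (x : {x : T | x != v}) := if val x == u then [set u; v] else [set val x].
have inpsi x : val x \in psi x by rewrite /psi; case: eqP => [->|_]; rewrite !inE eqxx.
apply: (@clique_model_pullback _ _ e _ psi).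
- by move=> x; apply/set0Pn; exists (val x).
- move=> x; rewrite /psi; case: eqP => _; [exact: cut_connected2|exact: cut_connected1].
- move=> x y; rewrite -val_eqE /psi => xy.
  have [xu|xu] := eqVneq (val x) u; have [yu|yu] := eqVneq (val y) u.
  + by rewrite xu yu eqxx in xy.
  + rewrite -setI_eq0; apply/set0Pn => -[z]; rewrite !inE => /andP[/orP[]/eqP-> /eqP zy].
      by rewrite zy eqxx in yu.
    by move: (valP y); rewrite -zy eqxx.
  + rewrite -setI_eq0; apply/set0Pn => -[z]; rewrite !inE => /andP[/eqP zx /orP[]/eqP zE].
      by rewrite -zx zE eqxx in xu.
    by move: (valP x); rewrite -zx zE eqxx.
  + by rewrite disjoints1 inE.
- move=> x y /or3P[exy|/andP[/andP[/eqP xu evy] yu]|/andP[/andP[/eqP yu exv] xu]]; apply/adjacentP.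
  + by exists (val x), (val y).
  + by exists v, (val y); rewrite /psi xu eqxx (negPf yu) !inE !eqxx orbT.
  + by exists (val x), v; rewrite /psi yu eqxx (negPf xu) !inE !eqxx orbT.
Qed.

Lemma card_sig_neq T (v : T) : #|{: {x : T | x != v}}| = #|T|.-1.
Proof. by rewrite card_sig -(cardC1 v); apply: eq_card => x; rewrite !inE. Qed.

(** Induction on the number of vertices. A vertex outside all branch sets is deleted; an edge inside
    a branch set is contracted; when neither exists, the branch sets are singletons covering the
    graph, which is then complete on [r] vertices. *)
Lemma clique_model_minor T (e : rel T) (r : nat) :
  simple_graph e -> clique_model e r -> is_minor (complete_graph r) e.
Proof.
move: {2}#|T| (leqnn #|T|) => m; elim: m T e => [|m IHm] T e cT sg [Bs [sz aB pB]].
  have T0 (x : T) : False by have := max_card (pred1 x); rewrite card1 leqNgt ltnS cT.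
  have r0 : r = 0.
    by rewrite -sz; case: Bs aB {sz pB} => //= B Bs /andP[/andP[/set0Pn[x _] _] _]; case: (T0 x).
  apply: (minor_trans _ (minor_refl _)).
  apply: (@ms_iso _ _ _ _ (fun x => match T0 x return 'I_r with end)) => [|x]; last by case: (T0 x).
  by apply: inj_card_bij => [x|]; [case: (T0 x) | rewrite card_ord r0].
have [se ie] := sg.
have cT' (v : T) : #|{: {x : T | x != v}}| <= m.
  by rewrite card_sig_neq; case: #|T| cT.
have [/existsP[v /allP vN]|/existsPn cov] := boolP [exists v, all (fun X : {set T} => v \notin X) Bs].
  apply: (minor_trans (ms_del_vertex e v)); apply: IHm (cT' v) _ _.
    by split=> [x y|x]; rewrite /del_vertex ?ie // se.
  exists [seq val @^-1: B | B : {set T} <- Bs]; split; first by rewrite size_map.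
    apply/allP => _ /mapP[B BBs ->]; have /andP[/set0Pn[x xB] cB] := allP aB _ BBs.
    have nv y : y \in B -> y != v by move=> yB; apply: contraNneq (vN _ BBs) => <-.
    apply/andP; split; first by apply/set0Pn; exists (Sub x (nv _ xB)); rewrite inE SubK.
    apply/cut_connectedP => X sX /set0Pn[z zX] XB.
    have [||| a [b [/imsetP[a' a'X ->] ]]] := cut_connectedP _ _ cB (val @: X).
    - by apply/subsetP => _ /imsetP[w wX ->]; have := subsetP sX _ wX; rewrite inE.
    - by apply/set0Pn; exists (val z); apply: imset_f.
    - apply: contra XB => /eqP XB; apply/eqP/setP => w.
      by rewrite inE -XB mem_imset //; apply: val_inj.
    rewrite inE => /andP[bX bB] eab; exists a', (Sub b (nv _ bB)); split=> //.
    rewrite !inE SubK bB andbT; apply: contra bX => bX.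
    by apply/imsetP; exists (Sub b (nv _ bB)); rewrite ?SubK.
  rewrite pairwise_map.
  apply: (sub_in_pairwise (P := mem Bs)) pB; last by apply/allP.
  move=> X Y XB YB /andP[dXY /adjacentP[x [y [xX yY exy]]]]; apply/andP; split.
    rewrite -setI_eq0 -preimsetI; move: dXY; rewrite -setI_eq0 => /eqP->.
    by rewrite preimset0.
  have xv : x != v by apply: contraNneq (vN _ XB) => <-.
  have yv : y != v by apply: contraNneq (vN _ YB) => <-.
  by apply/adjacentP; exists (Sub x xv), (Sub y yv); rewrite !inE !SubK.
have [/hasP[B BBs /card_gt1P[x [w [xB wB xw]]]]|/hasPn small] :=
  boolP (has (fun X : {set T} => 1 < #|X|) Bs).
  have /andP[_ cB] := allP aB _ BBs.
  have [|||x' [y [/set1P-> ]]] := cut_connectedP _ _ cB [set x].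
  - by rewrite sub1set.
  - by apply/set0Pn; exists x; rewrite inE.
  - by apply/eqP => E; move: wB; rewrite -E inE eq_sym (negPf xw).
  rewrite !inE => /andP[yx yB] exy.
  have xy : x != y by rewrite eq_sym.
  apply: (minor_trans (ms_contract exy)); apply: IHm (cT' y) (contract_simple _ _ sg) _.
  exists [seq merge_vertex xy @: B | B : {set T} <- Bs]; split; first by rewrite size_map.
    apply/allP => _ /mapP[X XBs ->]; have /andP[X0 cX] := allP aB _ XBs.
    rewrite imset_eq0 X0 /=; apply: cut_connected_imset cX => a b; exact: contract_merge.
  rewrite pairwise_map.
  (* Both ends of the contracted edge lie in [B], and the other branch sets are disjoint from [B],
     so every branch set contains both ends or neither. Merging them thus keeps the images
     disjoint. *)
  have xBu X : X \in Bs -> (x \in X) = (y \in X).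
    move=> XBs; have [->|XB] := eqVneq X B; first by rewrite xB yB.
    have dXB : [disjoint X & B].
      have /(pairwiseP set0) pw := pB.
      have iX : index X Bs < size Bs by rewrite index_mem.
      have iB : index B Bs < size Bs by rewrite index_mem.
      have [lt|lt|E] := ltngtP (index X Bs) (index B Bs).
      - by have := pw _ _ iX iB lt; rewrite !nth_index // => /andP[].
      - by have := pw _ _ iB iX lt; rewrite !nth_index // disjoint_sym => /andP[].
      - by case/eqP: XB; rewrite -(nth_index set0 XBs) E nth_index.
    by rewrite (disjointFl dXB xB) (disjointFl dXB yB).
  apply: (sub_in_pairwise (P := mem Bs)) pB; last by apply/allP.
  move=> X Y XBs YBs /andP[dXY /adjacentP[a [b [aX bY eab]]]].
  have dM : [disjoint merge_vertex xy @: X & merge_vertex xy @: Y].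
    rewrite -setI_eq0; apply/set0Pn => -[z]; rewrite inE.
    move=> /andP[/imsetP[p pX ->] /imsetP[q qY /(congr1 val)]]; rewrite !val_merge.
    have [py|py] := eqVneq p y; have [qy|qy] := eqVneq q y => E.
    - by move: (disjointFr dXY pX); rewrite py -qy qY.
    - by move: (disjointFl dXY qY); rewrite -E xBu // -py pX.
    - by move: (disjointFr dXY pX); rewrite E xBu // -qy qY.
    - by move: (disjointFr dXY pX); rewrite E qY.
  apply/andP; split=> //; apply/adjacentP; exists (merge_vertex xy a), (merge_vertex xy b).
  rewrite !imset_f //; split=> //; apply: contract_merge => //.
  by apply/eqP => E; move: (disjointFr dM (imset_f _ aX)); rewrite E imset_f.
have [g gE] : exists g : 'I_r -> T, forall i : 'I_r, nth set0 Bs i = [set g i].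
  apply: (fin_all_exists (T := 'I_r) (P := fun (i : 'I_r) x => nth set0 Bs i = [set x])) => i.
  have iB : nth set0 Bs i \in Bs by rewrite mem_nth // sz.
  have /andP[X0 _] := allP aB _ iB.
  have := small _ iB; rewrite -leqNgt leq_eqVlt ltnS leqn0 cards_eq0 (negPf X0) orbF.
  by move=> /cards1P.
have pw := pairwiseP set0 pB.
have gadj (i j : 'I_r) : i != j -> g i != g j /\ e (g i) (g j).
  move=> ij; wlog lt : i j ij / i < j.
    move=> W; have [lt|lt|/val_inj E] := ltngtP i j; first exact: W.
      by have [|H1 H2] := W j i _ lt; rewrite eq_sym // se.
    by rewrite E eqxx in ij.
  have := pw i j _ _ lt; rewrite !inE sz !ltn_ord => /(_ isT isT) /andP[].
  rewrite !gE disjoints1 inE => -> /adjacentP[a [b [/set1P-> /set1P-> ->]]].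
  by [].
have gI : injective g.
  by move=> i j gij; have [//|/gadj[]] := eqVneq i j; rewrite gij eqxx.
have gS x : exists i, g i = x.
  have /allPn[X XBs] := cov x; rewrite negbK => xX.
  have iX : index X Bs < r by rewrite -sz index_mem.
  exists (Ordinal iX); have := gE (Ordinal iX); rewrite /= nth_index // => XE.
  by have : x \in [set g (Ordinal iX)]; [rewrite -XE | move=> /set1P].
have [h hK] := fin_all_exists gS.
apply: (minor_trans _ (minor_refl _)); apply: (@ms_iso _ _ _ _ h).
  by exists g => // i; apply: gI; rewrite hK.
move=> x y; rewrite /complete_graph; have [E|ne] := eqVneq (h x) (h y).
  by rewrite -[x]hK -[y]hK E ie.
by have [_] := gadj _ _ ne; rewrite !hK => ->.
Qed.

(** * Edge density *)

(** Edges are counted through [arcs], that is as ordered pairs, so for a simple graph every edge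
    counts twice. *)
Definition nbrs T (e : rel T) (A : {set T}) (v : T) : {set T} := [set w in A | e v w].
Definition deg T (e : rel T) (A : {set T}) (v : T) : nat := #|nbrs e A v|.
Definition arcs T (e : rel T) (A : {set T}) : {set T * T} :=
  [set p | [&& p.1 \in A, p.2 \in A & e p.1 p.2]].

Lemma deg_sum T (e : rel T) (A : {set T}) (v : T) : deg e A v = \sum_(w in A) e v w.
Proof.
rewrite /deg -sum1_card [RHS]big_mkcond /= big_mkcond; apply: eq_bigr => w _.
by rewrite inE; case: (w \in A) => //; case: (e v w).
Qed.

Lemma sum_deg_sym T (e : rel T) (A B : {set T}) :
  symmetric e -> \sum_(v in A) deg e B v = \sum_(v in B) deg e A v.
Proof.
move=> se; under eq_bigr do rewrite deg_sum.
rewrite exchange_big; apply: eq_bigr => v _; rewrite deg_sum.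
by apply: eq_bigr => w _; rewrite se.
Qed.

Lemma card_arcs T (e : rel T) (A : {set T}) : #|arcs e A| = \sum_(v in A) deg e A v.
Proof.
under eq_bigr do rewrite deg_sum.
rewrite pair_big_dep /= -sum1_card big_mkcond [RHS]big_mkcond /=.
apply: eq_bigr => -[v w] _ /=; rewrite inE /=.
by case: (v \in A) => //; case: (w \in A) => //; case: (e v w).
Qed.

Lemma degS T (e : rel T) (A B : {set T}) (v : T) : A \subset B -> deg e A v <= deg e B v.
Proof.
move=> /subsetP sAB; apply/subset_leq_card/subsetP => w; rewrite !inE => /andP[wA ->].
by rewrite sAB.
Qed.

Lemma merge_inj_or T (u v : T) (uv : u != v) (a b : T) :
  merge_vertex uv a = merge_vertex uv b -> [\/ a = b, a = u /\ b = v | a = v /\ b = u].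
Proof.
move/(congr1 val); rewrite !val_merge.
by have [->|_] := eqVneq a v; have [->|_] := eqVneq b v => E;
  [constructor 1|constructor 3|constructor 2|constructor 1].
Qed.

(** The arcs lost are the two between [u] and [v], and, for each common neighbour [w], the two
    between [v] and [w], which become copies of those between [u] and [w]. Off this set [Bad] the
    quotient map is injective on arcs. *)
Lemma card_arcs_contract T (e : rel T) (u v : T) :
  simple_graph e -> e u v ->
  #|arcs e setT| <=
  #|arcs (contract e u v) setT| + (2 + 2 * #|[set w | e u w && e v w]|).
Proof.
move=> [se ie] euv.
have uv : u != v by apply: contraTneq euv => ->; rewrite ie.
set C := [set w | _].
pose Bad := [set (u, v); (v, u)] :|: ([set (v, w) | w in C] :|: [set (w, v) | w in C]).
have cB : #|Bad| <= 2 + 2 * #|C|.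
  apply: (leq_trans (leq_card_setU _ _)).
  apply: leq_add; first by rewrite cards2; case: eqP.
  apply: (leq_trans (leq_card_setU _ _)).
  by rewrite mul2n -addnn leq_add // leq_imset_card.
rewrite -(cardsID Bad (arcs e setT)) addnC leq_add //; last first.
  by apply: leq_trans cB; apply: subset_leq_card; apply: subsetIr.
pose phi (p : T * T) := (merge_vertex uv p.1, merge_vertex uv p.2).
have phiI : {in arcs e setT :\: Bad &, injective phi}.
  move=> [a b] [c d]; rewrite !inE /= => /andP[nB1 eab] /andP[nB2 ecd].
  have notC w : e u w -> e v w -> (v, w) \in Bad /\ (w, v) \in Bad.
    move=> uw vw; have wC : w \in C by rewrite inE uw.
    by split; rewrite !inE; apply/orP; right; apply/orP; [left|right]; apply: imset_f.
  have bad1 : (u, v) \in Bad by rewrite !inE eqxx.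
  have bad2 : (v, u) \in Bad by rewrite !inE eqxx orbT.
  have {}nB1 : (a, b) \notin Bad by rewrite !inE.
  have {}nB2 : (c, d) \notin Bad by rewrite !inE.
  move=> [/merge_inj_or[ac|[au cv]|[av cu]] /merge_inj_or[bd|[bu dv]|[bv du]]].
  - by rewrite ac bd.
  - rewrite bu se in eab; rewrite -ac dv se in ecd.
    by have [_] := notC a eab ecd; rewrite {1}ac -dv (negPf nB2).
  - rewrite -ac du se in ecd; rewrite bv se in eab.
    by have [_] := notC a ecd eab; rewrite -bv (negPf nB1).
  - rewrite au in eab; rewrite cv -bd in ecd.
    by have [] := notC b eab ecd; rewrite -cv bd (negPf nB2).
  - by rewrite au bu ie in eab.
  - by rewrite au bv bad1 in nB1.
  - rewrite cu -bd in ecd; rewrite av in eab.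
    by have [] := notC b ecd eab; rewrite -av (negPf nB1).
  - by rewrite av bu bad2 in nB1.
  - by rewrite av bv ie in eab.
rewrite -(card_in_imset phiI); apply: subset_leq_card; apply/subsetP => _ /imsetP[[a b] + ->].
rewrite inE => /andP[nB]; rewrite !inE /= => eab; apply: contract_merge => //=.
apply/eqP => /merge_inj_or[E|[E1 E2]|[E1 E2]]; move: eab nB => /=.
- by rewrite E ie.
- by rewrite E1 E2 !inE eqxx.
- by rewrite E1 E2 !inE eqxx orbT.
Qed.

Lemma clique_model_cons T U (e : rel T) (f : rel U) (h : U -> T) (v : T) (r : nat) :
  injective h -> (forall x y, f x y -> e (h x) (h y)) -> (forall x, e v (h x)) ->
  irreflexive e -> clique_model f r -> clique_model e r.+1.
Proof.
move=> hI hE hv ie [Bs [sz aB pB]]; exists ([set v] :: [seq h @: B | B : {set U} <- Bs]).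
have aB' X : X \in Bs -> (X != set0) && cut_connected f X by move/(allP aB).
split; first by rewrite /= size_map sz.
  rewrite /= cut_connected1 andbT; apply/andP; split.
    by apply/set0Pn; exists v; rewrite inE.
  apply/allP => _ /mapP[X /aB'/andP[X0 cX] ->]; rewrite imset_eq0 X0.
  by apply: cut_connected_imset cX => x y exy _; apply: hE.
rewrite /= pairwise_map; apply/andP; split.
  apply/allP => _ /mapP[X /aB'/andP[/set0Pn[x xX] _] ->]; apply/andP; split.
    rewrite disjoints1; apply/imsetP => -[y _ E].
    by have := hv y; rewrite -E ie.
  by apply/adjacentP; exists v, (h x); rewrite inE eqxx imset_f.
apply: sub_pairwise pB => X Y /andP[dXY /adjacentP[x [y [xX yY exy]]]].
apply/andP; split; first by rewrite imset_disjoint // in2W.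
by apply/adjacentP; exists (h x), (h y); rewrite !imset_f //; split => //; apply: hE.
Qed.

(** Mader's induction, for [r.+1]. An edge with fewer than [2 ^ r] common neighbours can be
    contracted: this loses one vertex and at most [2 ^ r.+1] arcs, so the density hypothesis
    survives. If there is no such edge, the graph on the neighbourhood of a nonisolated vertex [v]
    has minimum degree at least [2 ^ r]; it contains a model for [r], which [{v}] extends. *)
Lemma mader r T (e : rel T) : simple_graph e -> 0 < #|T| ->
  2 ^ r * #|T| <= #|arcs e setT| -> clique_model e r.
Proof.
elim: r T e => [|r IHr] T e; first by move=> _ _ _; exists [::].
move: {2}#|T| (leqnn #|T|) => m; elim: m T e => [|m IHm] T e cT sg T0 vol.
  by rewrite ltnNge cT in T0.
have [se ie] := sg.
have [/existsP[u /existsP[v /andP[euv cuv]]]|big] :=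
  boolP [exists u, [exists v, e u v && (#|[set w | e u w && e v w]| < 2 ^ r)]].
  have uv : u != v by apply: contraTneq euv => ->; rewrite ie.
  apply: (clique_model_contract se euv uv); apply: IHm.
  - by rewrite card_sig_neq; case: #|T| cT.
  - exact: contract_simple.
  - by apply/card_gt0P; exists (Sub u uv).
  - rewrite card_sig_neq -(leq_add2r (2 + 2 * #|[set w | e u w && e v w]|)).
    apply: leq_trans (card_arcs_contract sg euv); apply: leq_trans vol.
    case: #|T| T0 => // k _; rewrite succnK mulnS addnC leq_add2r expnS -mulnS.
    by rewrite leq_mul2l cuv orbT.
have : 0 < #|arcs e setT| by apply: leq_trans vol; rewrite muln_gt0 expn_gt0 T0.
move=> /card_gt0P[[v w]]; rewrite !inE /= => evw.
apply: (@clique_model_cons _ {x : T | e v x} e (fun x y => e (val x) (val y)) val v) => //.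
- exact: val_inj.
- by move=> x; exact: (valP x).
apply: IHr.
- by split=> [x y|x]; rewrite /= ?ie // se.
- by apply/card_gt0P; exists (exist _ w evw).
rewrite card_arcs -cardsT mulnC -sum_nat_const.
apply: leq_sum => -[x evx] _.
move: big => /existsPn/(_ v)/existsPn/(_ x); rewrite evx /= -leqNgt => /leq_trans; apply.
rewrite /deg -(card_imset (nbrs _ _ _) val_inj); apply: subset_leq_card.
apply/subsetP => y; rewrite inE => /andP[evy exy]; apply/imsetP.
by exists (exist _ y evy) => //; rewrite !inE.
Qed.

Lemma arcs_bound r T (e : rel T) (A : {set T}) : simple_graph e -> ~ clique_model e r ->
  \sum_(v in A) deg e A v <= 2 ^ r * #|A|.
Proof.
move=> [se ie] noK; rewrite -card_arcs leqNgt; apply/negP => lt; apply: noK.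
pose f : rel {x : T | x \in A} := fun x y => e (val x) (val y).
have cA : #|{: {x : T | x \in A}}| = #|A| by rewrite card_sig; apply: eq_card.
have cE : #|arcs e A| <= #|arcs f setT|.
  pose phi (p : {x : T | x \in A} * {x : T | x \in A}) := (val p.1, val p.2).
  rewrite -(card_imset (arcs f setT) (f := phi)).
    apply: subset_leq_card; apply/subsetP => -[a b]; rewrite inE /= => /and3P[aA bA eab].
    by apply/imsetP; exists (exist _ a aA, exist _ b bA); rewrite ?inE.
  by move=> [a b] [c d] [/val_inj-> /val_inj->].
apply: (clique_model_inj (f := f) (h := val)) => //; first exact: val_inj.
apply: mader.
- by split=> [x y|x]; rewrite /f /= ?ie // se.
- rewrite cA lt0n; apply/eqP => A0; move: lt; rewrite A0 muln0 => /card_gt0P[[a b]].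
  by rewrite inE; move/eqP: A0; rewrite cards_eq0 => /eqP->; rewrite inE.
- by rewrite cA; apply: leq_trans cE; apply: ltnW.
Qed.

Lemma clique_model_clique T (e : rel T) (A : {set T}) :
  {in A &, forall x y, x != y -> e x y} -> clique_model e #|A|.
Proof.
move=> cA; exists [seq [set x] | x <- enum A]; split; first by rewrite size_map -cardE.
  by apply/allP => _ /mapP[x _ ->]; rewrite cut_connected1 andbT; apply/set0Pn; exists x; rewrite inE.
rewrite pairwise_map.
have := enum_uniq A; rewrite uniq_pairwise.
apply: (sub_in_pairwise (P := mem A)); last by apply/allP => x; rewrite mem_enum.
move=> x y xA yA /= xy; rewrite /separate disjoints1 inE xy /=.
by apply/adjacentP; exists x, y; rewrite !inE !eqxx; split=> //; apply: cA.
Qed.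

Lemma clique_model_le T (e : rel T) (q r : nat) :
  q <= r -> clique_model e r -> clique_model e q.
Proof.
move=> qr [Bs [sz aB pB]]; exists (take q Bs); split.
- by rewrite size_take sz; case: ltngtP qr.
- by apply/allP => X /mem_take; apply: (allP aB).
- by apply: subseq_pairwise pB; apply: take_subseq.
Qed.

Lemma card_arcs_contract_lift T (e : rel T) (A : {set T}) (a a' b : T) :
  simple_graph e -> a \in A -> a' \in A -> b \notin A -> a != a' ->
  e a b -> e a' b -> ~~ e a a' ->
  2 + #|arcs e A| <= #|arcs (contract e a b) (val @^-1: A)|.
Proof.
move=> [se ie] aA a'A bA aa' eab ea'b naa'.
have nb x : x \in A -> x != b by move=> xA; apply: contraNneq bA => <-.
pose phi (p : {x : T | x != b} * {x : T | x != b}) := (val p.1, val p.2).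
have phiI : injective phi by move=> [x y] [z t] [/val_inj-> /val_inj->].
have dis : [disjoint [set (a, a'); (a', a)] & arcs e A].
  rewrite -setI_eq0; apply/set0Pn => -[[x y]]; rewrite !inE /= !xpair_eqE.
  by case/andP => /orP[]/andP[/eqP-> /eqP->] /and3P[_ _]; [|rewrite se]; apply/negP.
have -> : 2 + #|arcs e A| = #|[set (a, a'); (a', a)] :|: arcs e A|.
  by rewrite cardsU (disjoint_setI0 dis) cards0 subn0 cards2 xpair_eqE (negPf aa').
rewrite -(card_imset _ phiI); apply: subset_leq_card; apply/subsetP => -[x y] H.
have [xA yA cxy] : [/\ x \in A, y \in A & [|| e x y, (x == a) && (y == a') | (x == a') && (y == a)]].
  by move: H; rewrite !inE /= !xpair_eqE => /orP[/orP[]/andP[/eqP-> /eqP->]|/and3P[-> -> ->]];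
    rewrite ?aA ?a'A ?eqxx ?orbT.
apply/imsetP; exists (exist _ x (nb _ xA), exist _ y (nb _ yA)); last by [].
rewrite !inE /= xA yA /contract /=; case/or3P: cxy => [->//|/andP[/eqP-> /eqP->]|/andP[/eqP-> /eqP->]].
  by rewrite eqxx (se b) ea'b eq_sym aa' orbT.
by rewrite eqxx ea'b eq_sym aa' !orbT.
Qed.

(* Contract a vertex outside [A] into one of two nonadjacent neighbours inside [A]:
   the number of edges of [A] grows, so this stops after few steps. *)
Lemma few_high_degrees (s : nat) T (e : rel T) (A : {set T}) :
  simple_graph e -> ~ clique_model e s.+2 ->
  exists M : {set T}, [/\ 2 * #|M| <= 2 ^ s.+2 * #|A|
    & forall b, b \notin A -> b \notin M -> deg e A b <= s].
Proof.
(* Each contraction puts one vertex into [M] and creates at least two arcs inside [A], so the sum of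
   [2 * #|M|] and the number of arcs is what the induction can bound. *)
suff H (m : nat) : forall T (e : rel T) (A : {set T}), #|T| <= m ->
    simple_graph e -> ~ clique_model e s.+2 ->
    exists M : {set T}, 2 * #|M| + #|arcs e A| <= 2 ^ s.+2 * #|A|
      /\ forall b, b \notin A -> b \notin M -> deg e A b <= s.
  move=> sg noK; have [M [cM dM]] := H #|T| T e A (leqnn _) sg noK.
  by exists M; split=> //; apply: leq_trans cM; apply: leq_addr.
elim: m => [|m IHm] {}T {}e {}A cT sg noK.
  exists set0; split; first by rewrite cards0 card_arcs arcs_bound.
  by move=> b; have := max_card (pred1 b); rewrite card1 leqNgt ltnS; case: #|T| cT.
have [se ie] := sg.
have [/existsP[b /existsP[a /existsP[a' /and5P[bA /andP[aA a'A] aa' /andP[eab ea'b] naa']]]]|none] :=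
  boolP [exists b, [exists a, [exists a', [&& b \notin A, (a \in A) && (a' \in A), a != a',
    e a b && e a' b & ~~ e a a']]]].
  have ab : a != b by apply: contraNneq bA => <-.
  have [|||M [cM dM]] := IHm {x : T | x != b} (contract e a b) (val @^-1: A).
  - by rewrite card_sig_neq; case: #|T| cT.
  - exact: contract_simple.
  - by apply: contra_not noK; apply: clique_model_contract.
  pose A' : {set {x : T | x != b}} := val @^-1: A.
  have cA : #|A'| = #|A|.
    rewrite -(card_imset A' val_inj).
    apply: eq_card => x; apply/imsetP/idP => [[y] + ->|xA]; first by rewrite inE.
    have xb : x != b by apply: contraNneq bA => <-.
    by exists (exist _ x xb); rewrite ?inE.
  exists (b |: val @: M); split.
    have := card_arcs_contract_lift sg aA a'A bA aa' eab ea'b naa'.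
    have : #|b |: val @: M| <= 1 + #|M|.
      by rewrite cardsU1 (card_imset _ val_inj) leq_add2r; case: (_ \notin _).
    by move: cM; rewrite -/A' cA -/A'; set X := #|arcs _ A'|; set Y := #|arcs e A|; lia.
  move=> x xA; rewrite in_setU1 negb_or => /andP[xb xM].
  have := dM (exist _ x xb); rewrite !inE /= => /(_ xA) le.
  apply: leq_trans (le _); last by apply: contra xM => xM; apply/imsetP; exists (exist _ x xb).
  rewrite /deg -(card_imset (nbrs (contract e a b) _ _) val_inj); apply: subset_leq_card.
  apply/subsetP => y; rewrite inE => /andP[yA exy].
  have yb : y != b by apply: contraNneq bA => <-.
  by apply/imsetP; exists (exist _ y yb) => //; rewrite !inE yA /contract /= exy.
exists set0; split; first by rewrite cards0 card_arcs arcs_bound.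
(* No contraction is possible any more, so the neighbours in [A] of an outside vertex [b] form a
   clique; with [b] itself, more than [s] of them would give [K_{s+2}]. *)
move=> b bA _; rewrite leqNgt; apply/negP => lt; apply: noK.
apply: (@clique_model_le _ _ _ (#|b |: nbrs e A b|)).
  by rewrite cardsU1 inE (negPf bA) /= add1n ltnS.
apply: clique_model_clique => x y; rewrite !in_setU1 !inE.
move=> /orP[/eqP->|/andP[xA ebx]] /orP[/eqP->|/andP[yA eby]]; rewrite ?eqxx // => xy.
  by rewrite se.
apply: contraR none => nexy; apply/existsP; exists b; apply/existsP; exists x; apply/existsP; exists y.
by rewrite bA xA yA xy se ebx se eby.
Qed.

(** Only vertices of the exceptional set [M] have positive excess, the subtraction being truncated.
    Their degrees into [A] are at most those inside [M :|: A], a set of size linear in [#|A|], to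
    which the linear arc bound applies. *)
Lemma excess_bound (s : nat) T (e : rel T) (A : {set T}) :
  simple_graph e -> ~ clique_model e s.+2 ->
  \sum_(v in ~: A) (deg e A v - s) <= 2 ^ s.+2 * (2 ^ s.+2).+1 * #|A|.
Proof.
move=> sg noK; have [M [cM dM]] := few_high_degrees A sg noK.
set K := 2 ^ s.+2 in cM *.
have cMA : #|M :|: A| <= K.+1 * #|A|.
  by apply: (leq_trans (leq_card_setU _ _)); lia.
apply: (@leq_trans (K * #|M :|: A|)); last by rewrite -mulnA leq_mul2l cMA orbT.
apply: leq_trans (arcs_bound (M :|: A) sg noK).
rewrite big_mkcond [leqRHS]big_mkcond /=; apply: leq_sum => v _.
rewrite !inE; have [vA|vA] := boolP (v \in A) => //=; rewrite orbF.
have [vM|vM] := boolP (v \in M); last by rewrite (eqP (dM _ vA vM : deg e A v - s == 0)).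
by apply: (leq_trans (leq_subr _ _)); apply: degS; apply: subsetUr.
Qed.

(** * Common neighbourhoods and clique minors *)

Definition common_nbrs T (e : rel T) (L : {set T}) : {set T} := [set v | [forall l in L, e l v]].

Lemma common_nbrsP T (e : rel T) (L : {set T}) (v l : T) :
  v \in common_nbrs e L -> l \in L -> e l v.
Proof. by rewrite inE => /forall_inP; apply. Qed.

(** Match each [l] in [L] with its own vertex [g l] of [B] outside [X] and [Y]. The pairs [{l, g l}]
    are mutually adjacent, since [l] sees every [g l'], and each is adjacent to [X] and [Y], since
    these meet [B]. With [X] and [Y] this makes [#|L| + 2] branch sets. *)
Lemma clique_model_common_nbrs T (e : rel T) (L X Y : {set T}) :
  simple_graph e -> let B := common_nbrs e L in
  cut_connected e X -> cut_connected e Y -> separate e X Y ->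
  [disjoint L & X] -> [disjoint L & Y] -> X :&: B != set0 -> Y :&: B != set0 ->
  #|L| <= #|B :\: (X :|: Y)| -> clique_model e #|L|.+2.
Proof.
move=> [se ie] B cX cY sXY dLX dLY XB YB cL.
pose bs := enum (B :\: (X :|: Y)).
(* The default [l] is never reached: by [ilt] the index of an element of [L] lies within [bs]. *)
pose g l := nth l bs (index l (enum L)).
have ilt l : l \in L -> index l (enum L) < size bs.
  move=> lL; rewrite /bs -cardE; apply: leq_trans cL.
  by rewrite [X in _ < X]cardE index_mem mem_enum.
have gP l : l \in L -> [/\ g l \in B, g l \notin X & g l \notin Y].
  move=> lL; have : g l \in bs by rewrite mem_nth // ilt.
  by rewrite mem_enum in_setD in_setU negb_or => /andP[/andP[-> ->] ->].
have gI : {in L &, injective g}.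
  move=> l l' lL l'L; rewrite /g (set_nth_default l) ?ilt // => /eqP.
  rewrite nth_uniq ?ilt ?enum_uniq // => /eqP E.
  by rewrite -(nth_index l (s := enum L) (x := l)) ?mem_enum // E nth_index ?mem_enum.
have LB l : l \in L -> l \notin B.
  by move=> lL; apply/negP => /common_nbrsP/(_ lL); rewrite ie.
have sepg (Z : {set T}) l : Z \in [:: X; Y] -> l \in L -> separate e Z [set l; g l].
  move=> ZXY lL; have [gB gX gY] := gP _ lL.
  have [b bZ] : exists b, b \in Z :&: B.
    by move: ZXY; rewrite !inE => /orP[]/eqP->; apply/set0Pn.
  have dZ : [disjoint L & Z] by move: ZXY; rewrite !inE => /orP[]/eqP->.
  have gZ : g l \notin Z by move: ZXY; rewrite !inE => /orP[]/eqP->.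
  move: bZ; rewrite inE => /andP[bZ bB]; apply/andP; split.
    rewrite disjoint_sym -setI_eq0; apply/set0Pn => -[z]; rewrite !inE => /andP[/orP[]/eqP-> zZ].
      by rewrite (disjointFr dZ lL) in zZ.
    by rewrite zZ in gZ.
  apply/adjacentP; exists b, l; rewrite !inE eqxx; split=> //.
  by rewrite se; apply: common_nbrsP bB lL.
exists (X :: Y :: [seq [set l; g l] | l <- enum L]); split.
- by rewrite /= size_map -cardE.
- rewrite /= cX cY !andbT; apply/and3P; split.
  + by apply: contra XB => /eqP->; rewrite set0I.
  + by apply: contra YB => /eqP->; rewrite set0I.
  apply/allP => _ /mapP[l + ->]; rewrite mem_enum => lL.
  have [gB _ _] := gP _ lL; apply/andP; split.
    by apply/set0Pn; exists l; rewrite !inE eqxx.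
  by apply: cut_connected2 => //; apply: common_nbrsP gB lL.
- rewrite /= sXY /=; apply/and3P; split.
  + by apply/allP => _ /mapP[l + ->]; rewrite mem_enum => lL; rewrite sepg ?mem_head.
  + by apply/allP => _ /mapP[l + ->]; rewrite mem_enum => lL; rewrite sepg // !inE eqxx orbT.
  rewrite pairwise_map.
  have := enum_uniq L; rewrite uniq_pairwise.
  apply: (sub_in_pairwise (P := mem L)); last by apply/allP => x; rewrite mem_enum.
  move=> l l' lL l'L /= ll'; have [gB _ _] := gP _ lL; have [g'B _ _] := gP _ l'L.
  apply/andP; split.
    rewrite -setI_eq0; apply/set0Pn => -[z].
    rewrite !inE => /andP[/orP[]/eqP-> /orP[]/eqP E].
    - by rewrite E eqxx in ll'.
    - by move: (LB _ lL); rewrite E g'B.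
    - by move: (LB _ l'L); rewrite -E gB.
    - by rewrite (gI _ _ lL l'L E) eqxx in ll'.
  apply/adjacentP; exists l, (g l'); rewrite !inE !eqxx orbT; split=> //.
  exact: common_nbrsP g'B lL.
Qed.

(** The ends of an edge inside the common neighbourhood would serve as the two additional branch
    sets, and [s] further common neighbours remain for the matching. *)
Lemma common_nbrs_indep T (e : rel T) (L : {set T}) (s : nat) :
  simple_graph e -> ~ clique_model e s.+2 -> #|L| = s -> s.+2 <= #|common_nbrs e L| ->
  {in common_nbrs e L &, forall x y, ~~ e x y}.
Proof.
move=> sg noK cL cB x y xB yB; apply/negP => exy; apply: noK; rewrite -cL.
have [se ie] := sg.
have nL z : z \in common_nbrs e L -> z \notin L.
  by move=> zB; apply/negP => /(common_nbrsP zB); rewrite ie.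
have xy : x != y by apply: contraTneq exy => ->; rewrite ie.
apply: (@clique_model_common_nbrs _ e L [set x] [set y]) => //.
- exact: cut_connected1.
- exact: cut_connected1.
- by rewrite /separate disjoints1 inE xy; apply/adjacentP; exists x, y; rewrite !inE !eqxx.
- by rewrite disjoint_sym disjoints1 nL.
- by rewrite disjoint_sym disjoints1 nL.
- by apply/set0Pn; exists x; rewrite inE set11.
- by apply/set0Pn; exists y; rewrite inE set11.
- rewrite cL; have := cardsD (common_nbrs e L) [set x; y].
  have := subset_leq_card (subsetIr (common_nbrs e L) [set x; y]).
  by rewrite cards2 xy; move: cB; lia.
Qed.

(** Two neighbours [x], [y] of [c] in the common neighbourhood give the branch sets [{x}] and
    [{c, y}], joined by the edge [x c]. *)
Lemma common_nbrs_degree T (e : rel T) (L : {set T}) (s : nat) (c : T) :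
  simple_graph e -> ~ clique_model e s.+2 -> #|L| = s -> s.+2 <= #|common_nbrs e L| ->
  c \notin L -> c \notin common_nbrs e L -> deg e (common_nbrs e L) c <= 1.
Proof.
move=> sg noK cL cB cNL cNB; rewrite leqNgt; apply/negP => /card_gt1P[x [y []]].
rewrite !in_set => /andP[xB ecx] /andP[yB ecy] xy; apply: noK; rewrite -cL.
have {}xB : x \in common_nbrs e L by rewrite in_set.
have {}yB : y \in common_nbrs e L by rewrite in_set.
have [se ie] := sg.
have nL z : z \in common_nbrs e L -> z \notin L.
  by move=> zB; apply/negP => /(common_nbrsP zB); rewrite ie.
have cx : c != x by apply: contraNneq cNB => ->.
apply: (@clique_model_common_nbrs _ e L [set x] [set c; y]) => //.
- exact: cut_connected1.
- exact: cut_connected2.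
- rewrite /separate disjoints1 !inE negb_or eq_sym cx xy /=.
  by apply/adjacentP; exists x, c; rewrite !inE !eqxx se.
- by rewrite disjoint_sym disjoints1 nL.
- rewrite -setI_eq0; apply/set0Pn => -[z]; rewrite !inE => /andP[zL /orP[]/eqP E].
    by rewrite -E zL in cNL.
  by move: (nL _ yB); rewrite -E zL.
- by apply/set0Pn; exists x; rewrite inE set11.
- by apply/set0Pn; exists y; rewrite in_setI yB in_set2 eqxx orbT.
- have -> : common_nbrs e L :\: ([set x] :|: [set c; y]) = common_nbrs e L :\: [set x; y].
    apply/setP => z; rewrite !in_setD !in_setU !in_set1.
    by have [->|_] := eqVneq z c; rewrite ?(negPf cNB) ?andbF.
  rewrite cL; have := cardsD (common_nbrs e L) [set x; y].
  have := subset_leq_card (subsetIr (common_nbrs e L) [set x; y]).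
  by rewrite cards2 xy; move: cB; lia.
Qed.

(** * Vertices of almost full degree *)

Local Open Scope ring_scope.

Lemma deg_sumR (R : nzRingType) T (e : rel T) (A : {set T}) (v : T) :
  (deg e A v)%:R = \sum_(w in A) (e v w)%:R :> R.
Proof. by rewrite deg_sum natr_sum. Qed.

(** The hypotheses give [\sum d (n - d) <= 5 delta n ^ 2], so the values cluster near [0] and [n].
    Cutting at [n / 2], where one of the two factors is at least [n / 2], doubles the constant to
    [10] on either side. *)
Lemma concentrated_sum (R : realFieldType) T (A : {set T}) (d : T -> R) (n delta : R) (s : nat) :
  0 < n -> 0 <= delta -> 14 * delta < 1 ->
  (forall w, w \in A -> 0 <= d w <= n) ->
  \sum_(w in A) d w <= n * (s%:R + delta) ->
  n ^+ 2 * (s%:R - 4 * delta) <= \sum_(w in A) d w ^+ 2 ->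
  exists L : {set T}, [/\ L \subset A, #|L| = s & \sum_(w in L) (n - d w) <= 10 * delta * n].
Proof.
move=> n0 delta0 delta1 dA S1 S2.
have var : \sum_(w in A) d w * (n - d w) <= 5 * delta * n ^+ 2.
  rewrite (eq_bigr (fun w => n * d w - d w ^+ 2)); last by move=> w _; ring.
  by rewrite sumrB -mulr_sumr; have := ler_wpM2l (ltW n0) S1; lra.
pose G := [set w in A | n / 2 <= d w].
have sGA : G \subset A by apply/subsetP => w; rewrite inE => /andP[].
have term0 w : w \in A -> 0 <= d w * (n - d w).
  by move=> /dA/andP[d0 dn]; rewrite mulr_ge0 // subr_ge0.
have varB (B : {set T}) : B \subset A -> \sum_(w in B) d w * (n - d w) <= 5 * delta * n ^+ 2.
  move=> sBA; apply: le_trans var; rewrite [leRHS](big_setID B) /= (setIidPr sBA) lerDl.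
  by apply: sumr_ge0 => w; rewrite inE => /andP[_ /term0].
have half (a : R) : n / 2 * a <= 5 * delta * n ^+ 2 -> a <= 10 * delta * n.
  by move=> h; rewrite -(ler_pM2l n0); lra.
have defG (B : {set T}) : B \subset G -> \sum_(w in B) (n - d w) <= 10 * delta * n.
  move=> sBG; apply: half; apply: le_trans (varB B (subset_trans sBG sGA)).
  rewrite mulr_sumr; apply: ler_sum => w /(subsetP sBG); rewrite inE => /andP[/dA/andP[_ dn] hw].
  by apply: ler_wpM2r => //; rewrite subr_ge0.
have offG : \sum_(w in A :\: G) d w <= 10 * delta * n.
  apply: half; apply: le_trans (varB (A :\: G) (subsetDl _ _)).
  rewrite mulr_sumr; apply: ler_sum => w; rewrite !inE => /andP[+ wA].
  rewrite wA /= -ltNge => hw; have /andP[d0 dn] := dA _ wA.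
  by rewrite mulrC; apply: ler_wpM2l => //; lra.
have total : n * (s%:R - 4 * delta) <= \sum_(w in A) d w.
  rewrite -(ler_pM2l n0) mulrA -expr2; apply: (le_trans S2).
  rewrite mulr_sumr; apply: ler_sum => w /dA/andP[d0 dn].
  by rewrite expr2; apply: ler_wpM2r.
(* The sum is at least [n (s - 4 delta)] and the small values contribute at most [10 delta n], so
   [#|G| >= s - 14 delta > s - 1]. *)
have sG : (s <= #|G|)%N.
  rewrite -ltnS -(ltr_nat R) -natr1.
  have up : \sum_(w in G) d w <= #|G|%:R * n.
    rewrite -sumr_const mulr_suml; apply: ler_sum => w /(subsetP sGA)/dA/andP[_ dn].
    by rewrite mul1r.
  rewrite (big_setID G) /= (setIidPr sGA) in total.
  by rewrite -(ltr_pM2l n0); nra.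
have /set0Pn[L] : [set L : {set T} | (L \subset G) && (#|L| == s)] != set0.
  by rewrite -card_gt0 cards_draws bin_gt0.
rewrite inE => /andP[sLG /eqP cL]; exists L; split=> //; first exact: subset_trans sLG sGA.
exact: defG.
Qed.

(** Expand the eigenvalue inequality twice and sort the walks [u, v, w]: those ending outside [L]
    carry weight at most [eps], those with [v] and [w] in [L] are bounded by the arcs inside [L],
    and the remaining ones form the main term. *)
Lemma walk_bound (R : realFieldType) T (e : rel T) (y : T -> R) (l eps : R) (L : {set T}) (u : T) :
  0 <= l -> 0 <= eps -> (forall v, 0 <= y v <= 1) ->
  (forall v, l * y v <= \sum_w (e v w)%:R * y w) ->
  (forall w, w \notin L -> y w <= eps) ->
  l ^+ 2 * y u <= eps * (\sum_(v in setT) deg e setT v)%:R + (\sum_(v in L) deg e L v)%:R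
    + \sum_(v in ~: L) (e u v)%:R * \sum_(w in L) (e v w)%:R * y w.
Proof.
move=> l0 eps0 y01 ev small.
have y0 v : 0 <= y v by have /andP[] := y01 v.
have y1 v : y v <= 1 by have /andP[] := y01 v.
have step1 : l ^+ 2 * y u <= \sum_v (e u v)%:R * \sum_w (e v w)%:R * y w.
  rewrite expr2 -mulrA; apply: (le_trans (ler_wpM2l l0 (ev u))).
  rewrite mulr_sumr; apply: ler_sum => v _.
  by rewrite mulrCA; apply: ler_wpM2l (ev v); apply: ler0n.
apply: (le_trans step1).
have -> : \sum_v (e u v)%:R * (\sum_w (e v w)%:R * y w) =
    \sum_v (e u v)%:R * (\sum_(w | w \notin L) (e v w)%:R * y w)
    + \sum_v (e u v)%:R * (\sum_(w in L) (e v w)%:R * y w).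
  rewrite -big_split /=; apply: eq_bigr => v _.
  by rewrite (bigID (mem L)) /= mulrDr addrC.
rewrite -addrA; apply: lerD.
  rewrite natr_sum mulr_sumr big_mkcond /= [leRHS]big_mkcond /=; apply: ler_sum => v _; rewrite inE.
  apply: (@le_trans _ _ (\sum_(w | w \notin L) (e v w)%:R * y w)).
    rewrite -[leRHS]mul1r; apply: ler_wpM2r; first by apply: sumr_ge0 => w _; rewrite mulr_ge0.
    by rewrite lern1; case: (e u v).
  rewrite deg_sumR mulr_sumr big_mkcond [leRHS]big_mkcond /=; apply: ler_sum => w _.
  rewrite inE mulrC; case: ifP => [wL|_]; last by rewrite mulr_ge0.
  by apply: ler_wpM2r => //; apply: small.
rewrite (bigID (mem L)) /=; apply: lerD; last first.
  by rewrite le_eqVlt; apply/orP; left; apply/eqP; apply: eq_bigl => v; rewrite inE.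
rewrite natr_sum; apply: ler_sum => v vL; rewrite deg_sumR.
apply: (@le_trans _ _ (\sum_(w in L) (e v w)%:R * y w)).
  rewrite -[leRHS]mul1r; apply: ler_wpM2r; first by apply: sumr_ge0 => w _; rewrite mulr_ge0.
  by rewrite lern1; case: (e u v).
by apply: ler_sum => w _; rewrite -[leRHS]mulr1 ler_wpM2l.
Qed.

(** A middle vertex contributes at most its degree into [L], that is at most [s] plus its excess;
    the total excess over all vertices is small. *)
Lemma excess_walk (R : realFieldType) T (e : rel T) (y : T -> R) (L : {set T}) (s : nat) (u : T) :
  (forall v, 0 <= y v <= 1) ->
  \sum_(v in ~: L) (e u v)%:R * \sum_(w in L) (e v w)%:R * y w <=
  s%:R * (deg e (~: L) u)%:R + (\sum_(v in ~: L) (deg e L v - s))%:R.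
Proof.
move=> y01; rewrite deg_sumR mulr_sumr natr_sum -big_split /=; apply: ler_sum => v _.
have up : \sum_(w in L) (e v w)%:R * y w <= (deg e L v)%:R.
  rewrite deg_sumR; apply: ler_sum => w _; have /andP[_ y1] := y01 w.
  by rewrite -[leRHS]mulr1 ler_wpM2l.
case: (e u v) => /=; rewrite ?mul0r ?mulr0 ?add0r ?ler0n // mul1r mulr1.
by apply: (le_trans up); rewrite -natrD ler_nat; lia.
Qed.

(** With [d w] the degree of [w] into the complement of [L], walk counting gives
    [l ^ 2 * y w <= s * d w + E] for every [w], and [l ^ 2 <= E + \sum y w * d w] at the maximal
    entry. Substituting the first into the second forces a large [\sum d w ^ 2], while the excess
    bound keeps [\sum d w] small; then [concentrated_sum] applies. *)
Lemma heavy_vertices (R : realFieldType) T (e : rel T) (y : T -> R) (l : R) (s N K K' : nat) :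
  simple_graph e -> (0 < s)%N -> (0 < N)%N ->
  (forall A : {set T}, (\sum_(v in A) deg e A v <= K * #|A|)%N) ->
  (forall A : {set T}, (\sum_(v in ~: A) (deg e A v - s) <= K' * #|A|)%N) ->
  0 <= l -> (forall v, 0 <= y v <= 1) -> (exists u, y u = 1) ->
  (forall v, l * y v <= \sum_w (e v w)%:R * y w) ->
  s%:R * (#|T|%:R - s%:R) <= l ^+ 2 ->
  (2 * N ^ 4 * K ^ 2 + 2 * s + s ^ 2 * N + 1 <= #|T|)%N ->
  14 * (2 * K%:R + K'%:R + 1) < N%:R :> R ->
  exists L : {set T}, #|L| = s /\
    \sum_(w in L) (#|T|%:R - (deg e setT w)%:R) <= 10 * ((2 * K%:R + K'%:R + 1) / N%:R) * #|T|%:R :> R.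
Proof.
move=> [se ie] s0 N0 HK HK' l0 y01 [u0 yu0] ev lam big Nbig.
have y0 v : 0 <= y v by have /andP[] := y01 v.
pose n : R := #|T|%:R; pose delta : R := (2 * K%:R + K'%:R + 1) / N%:R.
have Nr : 0 < N%:R :> R by rewrite ltr0n.
have s1 : 1 <= s%:R :> R by rewrite ler1n.
have K0 : 0 <= K%:R :> R by []. have K'0 : 0 <= K'%:R :> R by [].
have n0 : 0 < n by rewrite ltr0n; apply: leq_trans big; rewrite addn1.
have delta0 : 0 <= delta by rewrite divr_ge0 //; lra.
have delta1 : 14 * delta < 1.
  by rewrite /delta mulrA ltr_pdivrMr // mul1r.
have [big1 big2 big3] : [/\ (2 * N ^ 4 * K ^ 2 <= #|T|), (2 * s <= #|T|) & (s ^ 2 * N <= #|T|)]%N.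
  by move: (2 * N ^ 4 * K ^ 2)%N (s ^ 2 * N)%N big => a b; clear => h; split; lia.
have n2s : 2 * s%:R <= n by rewrite -natrM ler_nat.
have sN : s%:R ^+ 2 <= delta * n.
  have : s%:R ^+ 2 * N%:R <= n by rewrite -natrX -natrM ler_nat.
  rewrite -ler_pdivlMr // => /le_trans; apply.
  rewrite mulrC; apply: ler_wpM2r; first exact: ltW.
  by rewrite /delta -[leLHS]mul1r; apply: ler_wpM2r; rewrite ?invr_ge0 //; lra.
pose L := [set v | 1 / N%:R <= y v].
have small w : w \notin L -> y w <= 1 / N%:R by rewrite inE -ltNge => /ltW.
(* An entry of at least [1 / N] forces degree at least [l / N], and the degrees sum to at most
   [K n]; since [l ^ 2 >= n / 2], the size of [L] is of order [sqrt n] only. *)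
have cL : #|L|%:R <= n / N%:R.
  have c1 : #|L|%:R * l <= N%:R * (K%:R * n).
    rewrite mulrC -ler_pdivrMl //.
    apply: (@le_trans _ _ (\sum_(v in L) l * y v)).
      rewrite -sumr_const mulr_sumr mulr_sumr; apply: ler_sum => v; rewrite inE => yv.
      by rewrite mulr1 mulrC; apply: ler_wpM2l => //; rewrite -[_^-1]mul1r.
    apply: (@le_trans _ _ (\sum_(v in setT) (deg e setT v)%:R)).
      rewrite big_mkcond [leRHS]big_mkcond /=; apply: ler_sum => v _; rewrite in_setT.
      case: ifP => _ //; rewrite deg_sumR.
      apply: (le_trans (ev v)); rewrite big_mkcond [leRHS]big_mkcond /=.
      apply: ler_sum => w _; rewrite inE -[leRHS]mulr1 ler_wpM2l //.
      by have /andP[] := y01 w.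
    by rewrite -natr_sum -natrM ler_nat; apply: leq_trans (HK setT) _; rewrite cardsT.
  have l2 : n / 2 <= l ^+ 2.
    apply: (le_trans _ lam); rewrite -/n.
    have p1 : 0 <= (n - 2 * s%:R) * (s%:R - 1) by rewrite mulr_ge0 ?subr_ge0.
    have p2 : 0 <= s%:R * (s%:R - 1) :> R by rewrite mulr_ge0 ?subr_ge0.
    lra.
  have c2 : #|L|%:R ^+ 2 * (n / 2) <= (N%:R * (K%:R * n)) ^+ 2.
    apply: (@le_trans _ _ ((#|L|%:R * l) ^+ 2)).
      by rewrite exprMn; apply: ler_wpM2l => //; apply: sqr_ge0.
    by rewrite ler_sqr ?nnegrE // !mulr_ge0.
  have big' : 2 * N%:R ^+ 4 * K%:R ^+ 2 <= n.
    rewrite (_ : _ * _ = (2 * N ^ 4 * K ^ 2)%:R); last by rewrite 2!natrM 2!natrX.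
    by rewrite ler_nat.
  rewrite ler_pdivlMr // -ler_sqr ?nnegrE ?(ltW n0) //; last by rewrite mulr_ge0.
  have n2 : 0 < n / 2 by rewrite divr_gt0.
  rewrite -(ler_pM2r n2) exprMn mulrAC.
  apply: (le_trans (ler_wpM2r (sqr_ge0 _) c2)).
  rewrite !exprMn; have nn : 0 <= n ^+ 2 by apply: sqr_ge0.
  have := ler_wpM2r nn big'; lra.
pose E : R := delta * n.
have cE : 1 / N%:R * (\sum_(v in setT) deg e setT v)%:R + (\sum_(v in L) deg e L v)%:R
     + (\sum_(v in ~: L) (deg e L v - s))%:R <= E.
  have h1 : (\sum_(v in setT) deg e setT v)%:R <= K%:R * n.
    by rewrite -natrM ler_nat; apply: leq_trans (HK setT) _; rewrite cardsT.
  have h2 : (\sum_(v in L) deg e L v)%:R <= K%:R * #|L|%:R :> R by rewrite -natrM ler_nat.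
  have h3 : (\sum_(v in ~: L) (deg e L v - s))%:R <= K'%:R * #|L|%:R :> R by rewrite -natrM ler_nat.
  have h4 : 1 / N%:R * (\sum_(v in setT) deg e setT v)%:R <= 1 / N%:R * (K%:R * n).
    by apply: ler_wpM2l => //; rewrite divr_ge0.
  have h5 := ler_wpM2l K0 cL; have h6 := ler_wpM2l K'0 cL.
  have -> : E = 1 / N%:R * (K%:R * n) + K%:R * (n / N%:R) + K'%:R * (n / N%:R) + n / N%:R.
    by rewrite /E /delta; field; rewrite gt_eqF.
  have : 0 <= n / N%:R by rewrite divr_ge0 ?ltW.
  lra.
have e0 : 0 <= 1 / N%:R :> R by rewrite divr_ge0.
pose d w : R := (deg e (~: L) w)%:R.
have E0 : 0 <= E by rewrite mulr_ge0 // ltW.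
have B1 u : l ^+ 2 * y u <= s%:R * d u + E.
  have := walk_bound u l0 e0 y01 ev small; have := excess_walk e L s u y01.
  by move: cE; rewrite /d; lra.
have dT w : d w <= n.
  by rewrite /d ler_nat; apply: (leq_trans (max_card _)).
have B2 : l ^+ 2 <= E + \sum_(w in L) y w * d w.
  have := walk_bound u0 l0 e0 y01 ev small.
  rewrite yu0 mulr1 => /le_trans; apply; apply: lerD.
    by apply: le_trans cE; rewrite lerDl.
  apply: (@le_trans _ _ (\sum_(v in ~: L) \sum_(w in L) (e v w)%:R * y w)).
    apply: ler_sum => v _; rewrite -[leRHS]mul1r; apply: ler_wpM2r.
      by apply: sumr_ge0 => w _; rewrite mulr_ge0.
    by rewrite lern1; case: (e u0 v).
  rewrite exchange_big /= ; apply: ler_sum => w _.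
  rewrite /d deg_sumR mulr_sumr; apply: ler_sum => v _.
  by rewrite mulrC se.
have S1 : \sum_(w in L) d w <= n * (s%:R + delta).
  rewrite -natr_sum (sum_deg_sym _ _ se).
  apply: (@le_trans _ _ ((s * #|T|)%:R + (\sum_(v in ~: L) (deg e L v - s))%:R)).
    rewrite -natrD ler_nat.
    apply: (@leq_trans (\sum_(v in ~: L) (s + (deg e L v - s)))).
      by apply: leq_sum => v _; rewrite -leq_subLR.
    by rewrite big_split /= leq_add2r sum_nat_const mulnC leq_mul2l max_card orbT.
  have : 0 <= 1 / N%:R * (\sum_(v in setT) deg e setT v)%:R :> R by rewrite mulr_ge0 ?divr_ge0.
  have : 0 <= (\sum_(v in L) deg e L v)%:R :> R by [].
  by rewrite natrM -/n mulrDr; move: cE; rewrite /E; lra.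
(* From [l ^ 2 * (l ^ 2 - E) >= (s n - 2 E) (s n - E)], which costs [3 s n E], and the term
   [E * \sum d w], which costs about [s n E] more, comes the constant [4]. *)
have S2 : n ^+ 2 * (s%:R - 4 * delta) <= \sum_(w in L) d w ^+ 2.
  have up : l ^+ 2 <= s%:R * n + E.
    by have := B1 u0; rewrite yu0 mulr1; have := ler_wpM2l (ler0n R s) (dT u0); lra.
  have h : l ^+ 2 * l ^+ 2 <= E * l ^+ 2 + \sum_(w in L) (s%:R * d w + E) * d w.
    apply: (le_trans (ler_wpM2l (sqr_ge0 l) B2)); rewrite mulrDr mulrC lerD2l mulr_sumr.
    by apply: ler_sum => w _; rewrite mulrA; apply: ler_wpM2r.
  have hs : \sum_(w in L) (s%:R * d w + E) * d w = s%:R * \sum_(w in L) d w ^+ 2 + E * \sum_(w in L) d w.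
    by rewrite !mulr_sumr -big_split /=; apply: eq_bigr => w _; ring.
  rewrite hs in h.
  have lo : s%:R * n - E <= l ^+ 2 by apply: (le_trans _ lam); rewrite -/n /E; lra.
  have h3 := ler_wpM2l E0 S1.
  set Q := \sum_(w in L) d w ^+ 2 in h *; set l2 := l ^+ 2 in up lo h.
  have E1 : 14 * E <= n by rewrite /E mulrA -[leRHS]mul1r; apply: ler_wpM2r; apply: ltW.
  have sn : n <= s%:R * n by rewrite -[leLHS]mul1r; apply: ler_wpM2r => //; apply: ltW.
  have lo2 : (s%:R * n - 2 * E) * (s%:R * n - E) <= l2 * (l2 - E).
    by rewrite [leRHS]mulrC; apply: ler_pM; lra.
  have E2 : 0 <= E ^+ 2 by apply: sqr_ge0.
  have s0r : 0 < s%:R :> R by rewrite ltr0n.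
  rewrite -(ler_pM2l s0r).
  have -> : s%:R * (n ^+ 2 * (s%:R - 4 * delta)) = s%:R ^+ 2 * n ^+ 2 - 4 * s%:R * n * E.
    by rewrite /E; ring.
  move: h3; rewrite (_ : n * (s%:R + delta) = s%:R * n + E); last by rewrite /E; ring.
  lra.
have [|L0 [_ cL0 dL0]] := concentrated_sum n0 delta0 delta1 _ S1 S2.
  by move=> w _; rewrite ler0n dT.
exists L0; split=> //; apply: le_trans dL0; apply: ler_sum => w _.
by rewrite lerB // ler_nat degS.
Qed.

Lemma card_common_nbrsC T (e : rel T) (L : {set T}) :
  (#|~: common_nbrs e L| <= \sum_(l in L) (#|T| - deg e setT l))%N.
Proof.
have sub : ~: common_nbrs e L \subset \bigcup_(l in L) ~: nbrs e setT l.
  apply/subsetP => v; rewrite !inE negb_forall => /existsP[l].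
  by rewrite negb_imply => /andP[lL nelv]; apply/bigcupP; exists l; rewrite // !inE.
apply: (leq_trans (subset_leq_card sub)).
apply: (@big_ind2 _ _ (fun (X : {set T}) k => #|X| <= k)%N); first by rewrite cards0.
  by move=> X k Y k' hX hY; apply: leq_trans (leq_card_setU _ _) (leq_add hX hY).
by move=> l _; rewrite cardsCs setCK.
Qed.

(** The eigenvector is replaced by its absolute values divided by their maximum; the triangle
    inequality gives the inequality that [heavy_vertices] expects, whatever the sign of [lam]. The
    threshold depends on [s] and [M] alone. *)
Lemma eigenvector_common_nbrs (s M : nat) : (0 < s)%N ->
  exists n0 : nat, forall (R : realFieldType) T (e : rel T) (x : T -> R) (lam : R),
    (n0 <= #|T|)%N -> simple_graph e -> ~ clique_model e s.+2 ->
    (forall v, \sum_w (e v w)%:R * x w = lam * x v) -> (exists v, x v != 0) ->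
    s%:R * (#|T|%:R - s%:R) <= lam ^+ 2 ->
    exists L : {set T}, [/\ #|L| = s, (M <= #|common_nbrs e L|)%N &
      (M * #|~: (L :|: common_nbrs e L)| <= #|common_nbrs e L|)%N].
Proof.
move=> s0.
pose K := (2 ^ s.+2)%N; pose K' := (K * K.+1)%N; pose Z := (2 * K + K' + 1)%N.
(* Makes the total defect [10 (Z / N) n] equal to [n / (2 (M + 1))], which bounds the number of
   vertices outside the common neighbourhood. *)
pose N := (20 * M.+1 * Z)%N.
exists (2 * N ^ 4 * K ^ 2 + 2 * s + s ^ 2 * N + 1 + 2 * M)%N => R T e x lam big sg noK ev [v0 xv0] hlam.
have Z0 : (0 < Z)%N by rewrite /Z addn1.
have N0 : (0 < N)%N by rewrite !muln_gt0 Z0.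
have ZE (R' : realFieldType) : 2 * K%:R + K'%:R + 1 = Z%:R :> R' by rewrite /Z 2!natrD natrM.
have [u _ umax] := @arg_maxP _ _ T v0 predT (fun v => `|x v|) isT.
have {}umax v : `|x v| <= `|x u| by apply: umax.
have xu : 0 < `|x u| by apply: lt_le_trans (umax v0); rewrite normr_gt0.
pose y v := `|x v| / `|x u|.
have [|||||||||L [cL dL]] := @heavy_vertices R T e y `|lam| s N K K' sg s0 N0.
- by move=> A; apply: arcs_bound.
- by move=> A; apply: excess_bound.
- exact: normr_ge0.
- by move=> v; rewrite divr_ge0 //= ler_pdivrMr // mul1r umax.
- by exists u; rewrite /y divff // gt_eqF.
- move=> v; rewrite mulrA ler_pdivrMr // -normrM -ev mulr_suml.
  apply: (le_trans (ler_norm_sum _ _ _)); apply: ler_sum => w _.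
  by rewrite normrM /y -mulrA divfK ?gt_eqF // normr_nat.
- by rewrite real_normK ?num_real.
- by apply: leq_trans big; apply: leq_addr.
- rewrite ZE -natrM ltr_nat /N.
  by rewrite ltn_pmul2r // mulnS.
have le1 : #|~: common_nbrs e L|%:R <= \sum_(w in L) (#|T|%:R - (deg e setT w)%:R) :> R.
  apply: (@le_trans _ _ (\sum_(w in L) (#|T| - deg e setT w))%:R).
    by rewrite ler_nat card_common_nbrsC.
  by rewrite natr_sum; apply: ler_sum => w _; rewrite natrB // max_card.
have small : (2 * M.+1 * #|~: common_nbrs e L| <= #|T|)%N.
  rewrite -(ler_nat R); have := le_trans le1 dL.
  rewrite ZE /N [(_ * M.+1 * Z)%:R]natrM [(20 * M.+1)%:R]natrM => le2.
  rewrite [(2 * M.+1 * _)%:R]natrM [(2 * M.+1)%:R]natrM.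
  have Zr : 0 < Z%:R :> R by rewrite ltr0n.
  have Mr : 0 < M.+1%:R :> R by rewrite ltr0n.
  have := ler_wpM2l (ltW Mr) le2.
  have -> : M.+1%:R * (10 * (Z%:R / (20 * M.+1%:R * Z%:R)) * #|T|%:R) = #|T|%:R / 2 :> R.
    move: (M.+1%:R : R) (Z%:R : R) Mr Zr => m z m0 z0.
    by field; rewrite !gt_eqF.
  lra.
have cB := cardsC (common_nbrs e L).
have big2 : (2 * M <= #|T|)%N by apply: leq_trans big; apply: leq_addl.
have sC : (#|~: (L :|: common_nbrs e L)| <= #|~: common_nbrs e L|)%N.
  by apply: subset_leq_card; rewrite setCS subsetUr.
move: cB small big2 sC cL; clear.
set b := #|common_nbrs e L|; set c := #|~: common_nbrs e L|; set n := #|T|.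
set d := #|~: _| => cB small big2 sC cL.
have h1 : (M * d <= M * c)%N by rewrite leq_mul2l sC orbT.
have h2 : (M * c + M * c + c <= b)%N by lia.
exists L; split=> //; last by rewrite -/b; lia.
(* For [c = 0] the bound on [M] comes from the summand [2 * M] of the threshold, otherwise from
   [M <= M * c]. *)
rewrite -/b; case: (posnP c) => [c0|c0]; first by lia.
have : (M <= M * c)%N by rewrite leq_pmulr.
lia.
Qed.

(** * Degree variance of a non-complete graph *)

Lemma big_disjointU (R : Type) (idx : R) (op : Monoid.com_law idx) T (A B : {set T}) (F : T -> R) :
  [disjoint A & B] ->
  \big[op/idx]_(i in A :|: B) F i = op (\big[op/idx]_(i in A) F i) (\big[op/idx]_(i in B) F i).
Proof. by move=> dAB; rewrite -bigU //; apply: eq_bigl => i; rewrite !inE. Qed.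

Lemma deg_setU T (e : rel T) (A B : {set T}) (v : T) :
  [disjoint A & B] -> deg e (A :|: B) v = (deg e A v + deg e B v)%N.
Proof. by move=> dAB; rewrite !deg_sum big_disjointU. Qed.

(** The local inequality behind de Caen's bound. Split [L] into [i], its neighbours [N] and the rest
    [R]; the arcs between [N] and [R] bound the degree sum over [N] from above, and count once more
    on the side of [R] in the total degree. *)
Lemma neighbour_degree_sum T (f : rel T) (L : {set T}) (i : T) : simple_graph f -> i \in L ->
  (#|L|.-1 * (deg f L i ^ 2 + \sum_(j in nbrs f L i) deg f L j)
    <= deg f L i * \sum_(j in L) deg f L j + deg f L i * (#|L|.-1 * #|L|.-2))%N.
Proof.
move=> [sf if_] iL; set S := #|L|.-1; set c := deg f L i; set N := nbrs f L i.
have [c0|c0] := posnP c.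
  have -> : N = set0 by apply/eqP; rewrite -cards_eq0; apply/eqP.
  by rewrite big_set0 c0 !mul0n addn0 muln0.
pose R := L :\: (i |: N).
have iN : i \notin N by rewrite inE if_ andbF.
have NL : N \subset L by apply/subsetP => j; rewrite inE => /andP[].
have iNL : i |: N \subset L by rewrite subUset sub1set iL.
have defL : L = [set i] :|: (N :|: R).
  apply/setP => j; rewrite !inE; have [->|_] := eqVneq j i; first by rewrite iL.
  by case: (j \in L); case: (f i j).
have dNR : [disjoint N & R].
  rewrite -setI_eq0; apply/eqP/setP => j; rewrite !inE.
  by case: (j \in L); case: (f i j); rewrite ?orbT ?andbF.
have di : [disjoint [set i] & N :|: R].
  by rewrite disjoints1 in_setU negb_or iN !inE eqxx.
have cR : #|R| = (S - c)%N.
  by rewrite cardsD (setIidPr iNL) cardsU1 iN /S -subn1 -subnDA.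
have cS : (c <= S)%N.
  rewrite /c /deg -/N /S -ltnS prednK; last by apply/card_gt0P; exists i.
  by have := subset_leq_card iNL; rewrite cardsU1 iN.
set sg := \sum_(j in N) _.
pose cut := (\sum_(j in N) deg f R j)%N.
have h1 : (sg <= c ^ 2 + cut)%N.
  have -> : (c ^ 2 = \sum_(j in N) c)%N by rewrite sum_nat_const -/c /c /deg -/N -mulnn.
  rewrite -big_split /=; apply: leq_sum => j jN.
  rewrite {1}defL !deg_setU // addnA leq_add2r.
  have cNj : (deg f N j <= #|N :\ j|)%N.
    apply: subset_leq_card; apply/subsetP => k; rewrite [in X in X -> _]inE => /andP[kN fjk].
    by rewrite in_setD1 kN andbT; apply: contraTneq fjk => ->; rewrite if_.
  have c1 : (deg f [set i] j <= 1)%N by rewrite deg_sum big_set1; case: (f j i).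
  apply: (leq_trans (leq_add c1 cNj)).
  by rewrite /c /deg -/N (cardsD1 j N) jN.
have h2 : (cut <= c * (S - c))%N.
  rewrite -cR /c /deg -/N -sum_nat_const; apply: leq_sum => j _.
  by apply: subset_leq_card; apply/subsetP => k; rewrite inE => /andP[].
have h3 : (c + sg + cut <= \sum_(j in L) deg f L j)%N.
  rewrite (eq_bigl (mem ([set i] :|: (N :|: R)))) => [|j]; last by rewrite {1}defL.
  rewrite big_disjointU //= big_set1 big_disjointU //= -/c -/sg -addnA !leq_add2l.
  rewrite /cut (sum_deg_sym N R sf); apply: leq_sum => j _.
  exact: degS.
set E := (\sum_(j in L) _)%N in h3 *.
move: (S - c)%N (subnKC cS) h2 => r <- h2; move: c0 h1 h2 h3; clear.
case: c => // c _; case: r => [|r] h1 h2 h3; nia.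
Qed.

(** De Caen's bound on the sum of squared degrees, [E] being twice the number of edges. It is the
    sum of the local inequalities, as each [deg j] appears once for every neighbour of [j]. *)
Lemma sum_deg_sqr_le T (f : rel T) (L : {set T}) : simple_graph f ->
  let E := (\sum_(i in L) deg f L i)%N in
  (2 * #|L|.-1 * \sum_(i in L) deg f L i ^ 2 <= E ^ 2 + E * (#|L|.-1 * #|L|.-2))%N.
Proof.
move=> sg /=; have [sf _] := sg; set E := (\sum_(i in L) deg f L i)%N.
have dbl : (\sum_(i in L) \sum_(j in nbrs f L i) deg f L j = \sum_(i in L) deg f L i ^ 2)%N.
  transitivity (\sum_(i in L) \sum_(j in L) (f i j) * deg f L j)%N.
    apply: eq_bigr => i _; rewrite big_mkcond [RHS]big_mkcond /=; apply: eq_bigr => j _.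
    by rewrite inE; case: (j \in L); case: (f i j); rewrite ?mul1n ?mul0n.
  rewrite exchange_big; apply: eq_bigr => j _; rewrite -big_distrl /= -mulnn; congr (_ * _)%N.
  by rewrite deg_sum; apply: eq_bigr => i _; rewrite sf.
have := @leq_sum _ (index_enum T) (mem L) _ _ (fun i (iL : i \in L) => neighbour_degree_sum sg iL).
rewrite -big_distrr /= big_split /= dbl big_split /= -!big_distrl /= -/E addnn -mul2n.
by rewrite mulnA (mulnC _ 2) -mulnn.
Qed.

Lemma deg_compl T (e : rel T) (L : {set T}) (i : T) : irreflexive e -> i \in L ->
  (deg e L i + deg (fun x y => (x != y) && ~~ e x y) L i = #|L|.-1)%N.
Proof.
move=> ie iL; rewrite [in RHS](cardsD1 i L) iL /= !deg_sum -big_split /=.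
rewrite (big_setD1 i) //= ie eqxx /= add0n -sum1_card; apply: eq_bigr => j.
by rewrite in_setD1 eq_sym => /andP[-> _]; case: (e i j).
Qed.

(* With [c_i] the degrees in the complement of the graph on [L] and [s = #|L|], the claim reads
   [4 s sum c_i ^ 2 < 2 s (s - 1) sum c_i + 3 (sum c_i) ^ 2]; it follows from de Caen's bound
   [2 (s - 1) sum c_i ^ 2 <= (sum c_i) ^ 2 + (s - 1) (s - 2) sum c_i]. *)
Lemma degree_variance T (e : rel T) (L : {set T}) (a b : T) : simple_graph e ->
  a \in L -> b \in L -> a != b -> ~~ e a b ->
  (4 * #|L| * \sum_(i in L) deg e L i ^ 2 + 1
    <= (#|L| * #|L|.-1) ^ 2 + 3 * (\sum_(i in L) deg e L i) ^ 2)%N.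
Proof.
move=> [se ie] aL bL ab neab.
pose f x y := (x != y) && ~~ e x y.
have sg : simple_graph f.
  by split=> [x y|x]; rewrite /f ?eqxx // eq_sym se.
have cf i : i \in L -> deg f L i = (#|L|.-1 - deg e L i)%N.
  by move=> iL; rewrite -(deg_compl ie iL) addKn.
have := sum_deg_sqr_le L sg.
set E := (\sum_(i in L) deg f L i)%N; set Q := (\sum_(i in L) deg f L i ^ 2)%N => /= main.
have s2 : (1 < #|L|)%N by apply/card_gt1P; exists a, b.
have E0 : (0 < E)%N.
  rewrite /E (bigD1 a) //= ltn_addr //; apply/card_gt0P; exists b.
  by rewrite inE bL /f ab neab.
have le i : i \in L -> (deg e L i <= #|L|.-1)%N.
  by move=> iL; rewrite -(deg_compl ie iL) leq_addr.
have EE : (E + \sum_(i in L) deg e L i = #|L| * #|L|.-1)%N.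
  rewrite -big_split /= -sum_nat_const; apply: eq_bigr => i iL.
  by rewrite addnC; apply: deg_compl.
have EL : (E <= #|L| * #|L|.-1)%N by rewrite -EE leq_addr.
have QQ : (\sum_(i in L) deg e L i ^ 2 + 2 * #|L|.-1 * E = Q + #|L| * #|L|.-1 ^ 2)%N.
  rewrite -sum_nat_const /E /Q big_distrr /= -!big_split /=; apply: eq_bigr => i iL.
  by rewrite -(deg_compl ie iL) -/f; ring.
move: main s2 E0 EE EL QQ; set D := (\sum_(i in L) deg e L i)%N.
set P := (\sum_(i in L) deg e L i ^ 2)%N; clear.
move: #|L| E Q D P => [|[|s]] // E Q D P; rewrite /= => main _ E0 EE EL QQ.
have QQ' : (P = Q + s.+2 * s.+1 ^ 2 - 2 * s.+1 * E)%N by rewrite -QQ addnK.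
suff: (4 * s.+2 * Q < 2 * s.+2 * s.+1 * E + 3 * E ^ 2)%N.
  have e1 : (E * E + E * D = E * (s.+2 * s.+1))%N by rewrite -mulnDr EE.
  have e2 : ((E + D) * (E + D) = (s.+2 * s.+1) * (s.+2 * s.+1))%N by rewrite EE.
  have e3 : (4 * s.+2 * (P + 2 * s.+1 * E) = 4 * s.+2 * (Q + s.+2 * s.+1 ^ 2))%N by rewrite QQ.
  move: e1 e2 e3; clear; lia.
suff: (s.+1 * (4 * s.+2 * Q) < s.+1 * (2 * s.+2 * s.+1 * E + 3 * E ^ 2))%N.
  by rewrite ltn_mul2l.
apply: (@leq_ltn_trans (2 * s.+2 * (E ^ 2 + E * (s.+1 * s)))).
  by have := leq_mul2l (2 * s.+2) (2 * s.+1 * Q) (E ^ 2 + E * (s.+1 * s)); rewrite main orbT; lia.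
have h : (E * E <= E * (s.+2 * s.+1))%N by rewrite leq_mul2l EL orbT.
have h2 : (0 < E * (s.+2 * s.+1))%N by rewrite muln_gt0 E0.
have h3 : (0 <= s * (E * E))%N by [].
move: h h2 h3; clear; lia.
Qed.

(** * The quadratic form inequality *)

Definition nbr_sum (R : nzRingType) T (e : rel T) (A : {set T}) (x : T -> R) (v : T) : R :=
  \sum_(w in A) (e v w)%:R * x w.

Lemma sqr_wsum_le (R : realFieldType) T (A : {set T}) (a x : T -> R) :
  (forall w, w \in A -> 0 <= a w) ->
  (\sum_(w in A) a w * x w) ^+ 2 <= (\sum_(w in A) a w) * \sum_(w in A) a w * x w ^+ 2.
Proof.
move=> a0; set S := \sum_(w in A) a w; set X := \sum_(w in A) _; set Q := \sum_(w in A) _.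
have S0 : 0 <= S by apply: sumr_ge0.
have [SE|Sn0] := eqVneq S 0.
  have az w : w \in A -> a w = 0.
    by move=> wA; move/eqP: SE; rewrite psumr_eq0 // => /allP/(_ w (mem_index_enum w)); rewrite wA => /eqP.
  have -> : X = 0 by apply: big1 => w /az->; rewrite mul0r.
  by rewrite expr0n /= SE mul0r.
have Spos : 0 < S by rewrite lt_def Sn0.
have : 0 <= \sum_(w in A) a w * (S * x w - X) ^+ 2.
  by apply: sumr_ge0 => w wA; rewrite mulr_ge0 ?sqr_ge0 // a0.
have -> : \sum_(w in A) a w * (S * x w - X) ^+ 2 = S * (S * Q - X ^+ 2).
  rewrite (eq_bigr (fun w => S ^+ 2 * (a w * x w ^+ 2) - 2 * S * X * (a w * x w) + X ^+ 2 * a w));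
    last by move=> w _; ring.
  by rewrite big_split /= sumrB -!mulr_sumr -/S -/X -/Q; ring.
by rewrite pmulr_rge0 // subr_ge0.
Qed.

Lemma nbr_sum_ge0 (R : realFieldType) T (e : rel T) (A : {set T}) (x : T -> R) v :
  (forall w, w \in A -> 0 <= x w) -> 0 <= nbr_sum e A x v.
Proof. by move=> x0; apply: sumr_ge0 => w wA; rewrite mulr_ge0 // x0. Qed.

Lemma nbr_sum_le (R : realFieldType) T (e : rel T) (A : {set T}) (x : T -> R) v :
  (forall w, w \in A -> 0 <= x w) -> nbr_sum e A x v <= \sum_(w in A) x w.
Proof.
move=> x0; apply: ler_sum => w wA; rewrite -[leRHS]mul1r ler_wpM2r ?x0 //.
by rewrite lern1; case: (e v w).
Qed.

Lemma sqr_nbr_sum_le (R : realFieldType) T (e : rel T) (A : {set T}) (x : T -> R) v :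
  nbr_sum e A x v ^+ 2 <= (deg e A v)%:R * nbr_sum e A (fun w => x w ^+ 2) v.
Proof. by rewrite deg_sumR; apply: sqr_wsum_le. Qed.

(** The Frobenius bound on a block of the adjacency matrix, whose squared Frobenius norm is its
    number of ones. *)
Lemma sum_sqr_nbr_sum_le (R : realFieldType) T (e : rel T) (A B : {set T}) (x : T -> R) :
  \sum_(v in A) nbr_sum e B x v ^+ 2 <= (\sum_(v in A) deg e B v)%:R * \sum_(w in B) x w ^+ 2.
Proof.
rewrite natr_sum mulr_suml; apply: ler_sum => v _; apply: (le_trans (sqr_nbr_sum_le _ _ _ _)).
by apply: ler_wpM2l => //; apply: nbr_sum_le => w _; apply: sqr_ge0.
Qed.

Lemma nbr_sum_sym (R : realFieldType) T (e : rel T) (A B : {set T}) (x y : T -> R) : symmetric e ->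
  \sum_(v in A) y v * nbr_sum e B x v = \sum_(w in B) x w * nbr_sum e A y w.
Proof.
move=> se; under eq_bigr do rewrite mulr_sumr.
rewrite exchange_big; apply: eq_bigr => w _; rewrite mulr_sumr.
by apply: eq_bigr => v _; rewrite se; ring.
Qed.

Lemma sum_nbr_sum (R : realFieldType) T (e : rel T) (A B : {set T}) (x : T -> R) : symmetric e ->
  \sum_(v in A) nbr_sum e B x v = \sum_(w in B) (deg e A w)%:R * x w.
Proof.
move=> se; rewrite exchange_big; apply: eq_bigr => w _; rewrite deg_sumR mulr_suml.
by apply: eq_bigr => v _; rewrite se.
Qed.

Lemma wsum_amgm (R : realFieldType) T (A : {set T}) (d x : T -> R) (m y tau : R) :
  0 < tau -> (forall w, w \in A -> 0 <= d w <= m) ->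
  2 * y * \sum_(w in A) d w * x w
    <= m * (tau * #|A|%:R * y ^+ 2 + tau^-1 * \sum_(w in A) x w ^+ 2).
Proof.
move=> tau0 dA.
have -> : m * (tau * #|A|%:R * y ^+ 2 + tau^-1 * \sum_(w in A) x w ^+ 2) =
    \sum_(w in A) m * (tau * y ^+ 2 + tau^-1 * x w ^+ 2).
  rewrite -mulr_sumr big_split /= sumr_const -mulr_sumr.
  by congr (_ * (_ + _)); rewrite -mulr_natr; ring.
rewrite mulr_sumr; apply: ler_sum => w /dA/andP[d0 dm].
have am : 2 * y * x w <= tau * y ^+ 2 + tau^-1 * x w ^+ 2.
  rewrite -subr_ge0 (_ : _ - _ = tau^-1 * (tau * y - x w) ^+ 2); last by field; rewrite gt_eqF.
  by rewrite mulr_ge0 ?sqr_ge0 // invr_ge0 ltW.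
have nn : 0 <= tau * y ^+ 2 + tau^-1 * x w ^+ 2.
  by rewrite addr_ge0 // mulr_ge0 ?sqr_ge0 ?invr_ge0 ?ltW.
apply: (@le_trans _ _ (d w * (tau * y ^+ 2 + tau^-1 * x w ^+ 2))); last exact: ler_wpM2r.
by rewrite (_ : _ * _ = d w * (2 * y * x w)); [apply: ler_wpM2l | ring].
Qed.

Lemma nbr_sum_amgm (R : realFieldType) T (e : rel T) (A : {set T}) (x : T -> R) v (a tau : R) :
  0 < tau ->
  2 * a * nbr_sum e A x v <= tau * #|A|%:R * a ^+ 2 + tau^-1 * \sum_(w in A) x w ^+ 2.
Proof.
move=> tau0; rewrite -[leRHS]mul1r; apply: wsum_amgm => // w _.
by rewrite ler0n lern1; case: (e v w).
Qed.

Lemma sum_sqr_mean (R : realFieldType) T (A : {set T}) (x : T -> R) (c : R) :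
  \sum_(w in A) x w = #|A|%:R * c ->
  \sum_(w in A) x w ^+ 2 = #|A|%:R * c ^+ 2 + \sum_(w in A) (x w - c) ^+ 2.
Proof.
move=> S; rewrite [X in _ = _ + X](eq_bigr (fun w => x w ^+ 2 - 2 * c * x w + c ^+ 2)); last first.
  by move=> w _; ring.
by rewrite big_split /= sumrB -mulr_sumr S sumr_const -mulr_natr; ring.
Qed.

(* Here [c], [w] are the means of [x] on [L] and [B], [P] and [Qb] its squared deviations from them,
   and [Z] its squared norm on [C]; [s], [p], [k] are the sizes of [L], [B], [C]. The left-hand side is
   [|(A - t) x| ^ 2] plus the slack left after paying for all terms involving [C]. *)
Lemma budget (R : realFieldType)
  (s p k K t tau c w P Qb Z F2 X G2 FG Gs H1 H2 V2 VE E2 XB XG B2 C2 : R) :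
  1 <= s -> 0 <= k -> 0 <= K -> 168 * s ^+ 3 <= p -> (80 * s + 76 * s * K) * k <= p ->
  0 <= P -> 0 <= Qb -> 0 <= Z -> t ^+ 2 <= (s - 1) ^+ 2 / 4 ->
  F2 + 2 * (p * w) * X + tau * (s * c ^+ 2 + p * w ^+ 2) <=
    (s - 1) ^+ 2 / 4 * (s * c ^+ 2) + ((s - 1) ^+ 2 / 4 - t ^+ 2) * (p * w ^+ 2) + (s * p - 1) * P ->
  G2 <= s * k * Z -> 2 * (p * w) * Gs <= (s - 1) * (k * p * w ^+ 2 + p * Z) ->
  V2 <= (s - 1) * k * (s * c ^+ 2 + P) ->
  2 * (s * c) * H1 <= k * (s * c ^+ 2 + P) / 8 + 8 * s * Z ->
  H2 <= k * Z -> 2 * VE <= k * (s * c ^+ 2 + P) / 8 + 8 * s * E2 ->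
  E2 <= 2 * B2 + 2 * C2 -> C2 <= K * k * Z -> B2 <= 2 * k * w ^+ 2 + 2 * k * Qb ->
  - (4 * t * XB) <= s * (Z + B2) -> - (2 * t * XG) <= s * (Z + C2) ->
  2 * FG <= k * (s * c ^+ 2 + P) / 8 + 32 * s ^+ 3 * Z ->
  F2 + s * (p * w) ^+ 2 + G2 + 2 * (p * w) * X + 2 * FG + 2 * (p * w) * Gs
    + p * (s * c) ^+ 2 + 2 * (s * c) * H1 + H2 + t ^+ 2 * (p * w ^+ 2 + Qb)
    + V2 + 2 * VE + E2 - 4 * t * XB - 2 * t * XG + t ^+ 2 * Z
    + (k / 2 * (s * c ^+ 2 + P) + k / 2 * (p * w ^+ 2) + p / 4 * Z + s * p / 2 * Qb + P
       + tau * (s * c ^+ 2 + p * w ^+ 2))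
  <= (s * (p + k) + (s - 1) ^+ 2 / 4) * (s * c ^+ 2 + P + (p * w ^+ 2 + Qb) + Z).
Proof.
move=> s1 k0 K0 hp hk P0 Q0 Z0 ht star hG2 hGs hV2 hH1 hH2 hVE hE2 hC2 hB2 hXB hXG hFG.
have s0 : 0 <= s by lra.
have s2 : s <= s ^+ 2 by rewrite expr2; nra.
have s3 : s <= s ^+ 3 by rewrite exprS; nra.
have w2 : 0 <= w ^+ 2 by apply: sqr_ge0.
have c2 : 0 <= c ^+ 2 by apply: sqr_ge0.
have p0 : 0 <= p by lra.
have kK : 0 <= k * K by apply: mulr_ge0.
have sk : k <= s * k by rewrite -[leLHS]mul1r ler_wpM2r.
have skK : K * k <= s * K * k by rewrite -mulrA -[leLHS]mul1r ler_wpM2r // mulr_ge0.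
have hk1 : 80 * s * k <= p by have := mulr_ge0 s0 kK; lra.
(* [E2] occurs with coefficient [8 s + 1]; doubling it into [B2] and [C2] and adding the [s] from
   the [XB] and [XG] terms yields [17 s + 2] for each. *)
have fE2 := ler_wpM2l (_ : 0 <= 8 * s + 1) hE2.
have {}fE2 : (8 * s + 1) * E2 <= (8 * s + 1) * (2 * B2 + 2 * C2) by apply: fE2; lra.
have fC2 : (17 * s + 2) * C2 <= (17 * s + 2) * (K * k * Z) by apply: ler_wpM2l => //; lra.
have fB2 : (17 * s + 2) * B2 <= (17 * s + 2) * (2 * k * w ^+ 2 + 2 * k * Qb).
  by apply: ler_wpM2l => //; lra.
(* Here [10 s + 32 s ^ 3 <= 42 s ^ 3] and [17 s + 2 <= 19 s]; the hypotheses carry [168 = 4 * 42]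
   and [76 = 4 * 19], so each of the two groups takes at most [p / 4]. *)
have fZ : (10 * s + 32 * s ^+ 3 + k + (17 * s + 2) * (K * k)) * Z <= p / 2 * Z.
  apply: ler_wpM2r => //.
  have : (17 * s + 2) * (K * k) <= 19 * (s * K * k) by lra.
  lra.
have hs1 : 0 <= s - 1 by lra.
have fw : (34 * s + 4) * k * w ^+ 2 <= p * k * w ^+ 2 / 2.
  have h76 : 0 <= p - 76 * s by lra.
  have := mulr_ge0 (mulr_ge0 k0 w2) h76.
  have := mulr_ge0 hs1 (mulr_ge0 k0 w2).
  lra.
have fQ : (34 * s + 4) * k * Qb <= s * p * Qb / 2.
  have h76 : 0 <= p - 76 * k by lra.
  have := mulr_ge0 (mulr_ge0 s0 Q0) h76.
  have := mulr_ge0 hs1 (mulr_ge0 k0 Q0).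
  lra.
have fK : 0 <= ((s - 1) ^+ 2 / 4 - t ^+ 2) * (Qb + Z) by rewrite mulr_ge0 ?subr_ge0 // addr_ge0.
have fP : 0 <= (s - 1) ^+ 2 / 4 * P by rewrite mulr_ge0 // divr_ge0 // sqr_ge0.
have fpZ : 0 <= p * Z by apply: mulr_ge0.
have fskQ := mulr_ge0 (mulr_ge0 s0 k0) Q0.
have fkP : 0 <= k * (s * c ^+ 2 + P) by apply: mulr_ge0 => //; apply: addr_ge0 => //; apply: mulr_ge0.
lra.
Qed.

Lemma deg_le_card_pred T (e : rel T) (L : {set T}) (l : T) :
  irreflexive e -> l \in L -> (deg e L l <= #|L|.-1)%N.
Proof. by move=> ie lL; rewrite -(deg_compl ie lL) leq_addr. Qed.

(* The part of the quadratic form inequality that depends only on the graph induced on [L]. *)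
Lemma induced_form_clique (R : realFieldType) T (e : rel T) (L : {set T}) (x : T -> R) (p w t c : R) :
  simple_graph e -> (0 < #|L|)%N -> {in L &, forall a b, a != b -> e a b} ->
  2 * t * #|L|%:R = (\sum_(l in L) deg e L l)%:R ->
  \sum_(l in L) x l = #|L|%:R * c -> #|L|%:R + 1 <= p ->
  forall s P : R, s = #|L|%:R -> P = \sum_(l in L) (x l - c) ^+ 2 ->
  \sum_(l in L) (nbr_sum e L x l - t * x l) ^+ 2
    + 2 * (p * w) * \sum_(l in L) ((deg e L l)%:R - 2 * t) * x l
  <= (s - 1) ^+ 2 / 4 * (s * c ^+ 2) + ((s - 1) ^+ 2 / 4 - t ^+ 2) * (p * w ^+ 2) + (s * p - 1) * P.
Proof.
move=> [se ie] L0 cL ht hc hp _ _ -> ->; set s := #|L|%:R; set P := \sum_(l in L) (x l - c) ^+ 2.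
have s1 : 1 <= s by rewrite ler1n.
have P0 : 0 <= P by apply: sumr_ge0 => l _; apply: sqr_ge0.
have degL l : l \in L -> (deg e L l)%:R = s - 1.
  move=> lL; rewrite /s (cardsD1 l L) lL natrD [true%:R + _]addrC addrK; congr (_%:R).
  apply: eq_card => w'; rewrite !inE andbC; have [->|ne] := eqVneq w' l; first by rewrite ie.
  by case w'L : (w' \in L); rewrite ?andbF // cL // eq_sym.
have tE : 2 * t = s - 1.
  have := ht; rewrite natr_sum (eq_bigr (fun=> s - 1)) // sumr_const -[RHS]mulr_natr.
  by move/mulIf; apply; rewrite pnatr_eq0 -lt0n.
have nE l : l \in L -> nbr_sum e L x l = s * c - x l.
  move=> lL; rewrite -hc (big_setD1 l lL) /= addrC addrK /nbr_sum (big_setD1 l lL) /= ie mul0r add0r.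
  apply: eq_bigr => w'; rewrite in_setD1 eq_sym => /andP[ne w'L].
  by rewrite cL // mul1r.
have X0 : \sum_(l in L) ((deg e L l)%:R - 2 * t) * x l = 0.
  by apply: big1 => l lL; rewrite degL // tE subrr mul0r.
have F2 : \sum_(l in L) (nbr_sum e L x l - t * x l) ^+ 2 = s * (s * c) ^+ 2
    - 2 * (1 + t) * (s * c) * (s * c) + (1 + t) ^+ 2 * (s * c ^+ 2 + P).
  rewrite (eq_bigr (fun l => (s * c) ^+ 2 - 2 * (1 + t) * (s * c) * x l + (1 + t) ^+ 2 * x l ^+ 2)).
    by rewrite big_split /= sumrB sumr_const -!mulr_sumr (sum_sqr_mean hc) hc -[_ *+ #|_|]mulr_natl.
  by move=> l lL; rewrite nE //; ring.
rewrite X0 F2 mulr0 addr0.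
have tE' : t = (s - 1) / 2 by lra.
have sp : (1 + t) ^+ 2 <= s * p - 1.
  have := ler_wpM2l (ltW (lt_le_trans ltr01 s1)) hp; rewrite tE'.
  have : 0 <= (s - 1) * s by rewrite mulr_ge0; lra.
  nra.
have := ler_wpM2r P0 sp; rewrite tE'; lra.
Qed.

(** Write [x = c + (x - c)] on [L], so that the mean part sees only the degrees. By
    [degree_variance] the critical coefficients stay below [(s - 1) ^ 2 / 4] by
    [1 / (4 s ^ 2) = 2 r]. One [r] pays for the errors made in separating mean and deviation, the
    other is the strict gain kept in the conclusion. *)
Lemma induced_form_nonclique (R : realFieldType) T (e : rel T) (L : {set T}) (x : T -> R)
  (a b : T) (p w t c : R) :
  simple_graph e -> a \in L -> b \in L -> a != b -> ~~ e a b ->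
  2 * t * #|L|%:R = (\sum_(l in L) deg e L l)%:R ->
  \sum_(l in L) x l = #|L|%:R * c -> 592 * #|L|%:R ^+ 9 <= p ->
  forall s P : R, s = #|L|%:R -> P = \sum_(l in L) (x l - c) ^+ 2 ->
  \sum_(l in L) (nbr_sum e L x l - t * x l) ^+ 2
    + 2 * (p * w) * \sum_(l in L) ((deg e L l)%:R - 2 * t) * x l
    + (8 * s ^+ 2)^-1 * (s * c ^+ 2 + p * w ^+ 2)
  <= (s - 1) ^+ 2 / 4 * (s * c ^+ 2) + ((s - 1) ^+ 2 / 4 - t ^+ 2) * (p * w ^+ 2) + (s * p - 1) * P.
Proof.
move=> sg aL bL ab neab ht hc hp _ _ -> ->; set s := #|L|%:R; set P := \sum_(l in L) (x l - c) ^+ 2.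
have [se ie] := sg.
have L0 : (0 < #|L|)%N by apply/card_gt0P; exists a.
have s1 : 1 <= s by rewrite ler1n.
have s0 : 0 < s by lra.
have P0 : 0 <= P by apply: sumr_ge0 => l _; apply: sqr_ge0.
pose D l : R := (deg e L l)%:R.
have D0 l : 0 <= D l by apply: ler0n.
have sP : #|L|.-1%:R = s - 1 by rewrite /s -[in RHS](prednK L0) -natr1 addrK.
have Ds l : l \in L -> D l <= s - 1.
  by move=> lL; have := deg_le_card_pred ie lL; rewrite -(ler_nat R) sP.
have SD : \sum_(l in L) D l = 2 * t * s by rewrite /D -natr_sum -ht.
have t0 : 0 <= 2 * t.
  by rewrite -(pmulr_lge0 _ s0) -SD; apply: sumr_ge0.
have ts : 2 * t <= s - 1.
  rewrite -(ler_pM2r s0) -SD.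
  have -> : (s - 1) * s = \sum_(l in L) (s - 1) by rewrite sumr_const -[RHS]mulr_natr.
  by apply: ler_sum => l lL; apply: Ds.
pose h2 := \sum_(l in L) (D l - 2 * t) ^+ 2.
(* [h2 / s] is the variance of the degrees; [degree_variance] bounds it away from the clique value. *)
have Q : \sum_(l in L) D l ^+ 2 = h2 + s * (2 * t) ^+ 2.
  by rewrite addrC; apply: sum_sqr_mean; rewrite SD mulrC.
have hvar : 4 * s * h2 + 4 * s ^+ 2 * t ^+ 2 + 1 <= s ^+ 2 * (s - 1) ^+ 2.
  have := degree_variance sg aL bL ab neab.
  rewrite -(ler_nat R) [(_ + 1)%:R]natrD [(_ + 3 * _)%:R]natrD.
  have -> : (4 * #|L| * \sum_(i in L) deg e L i ^ 2)%:R = 4 * s * \sum_(l in L) D l ^+ 2 :> R.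
    by rewrite 2!natrM natr_sum; congr (_ * _); apply: eq_bigr => l _; rewrite natrX.
  have -> : (((#|L| * #|L|.-1) ^ 2))%:R = (s * (s - 1)) ^+ 2 :> R.
    by rewrite natrX natrM sP.
  have -> : (3 * (\sum_(i in L) deg e L i) ^ 2)%:R = 3 * (2 * t * s) ^+ 2 :> R.
    by rewrite natrM natrX -SD natr_sum.
  by rewrite Q; lra.
have h20 : 0 <= h2 by apply: sumr_ge0 => l _; apply: sqr_ge0.
pose psi l := nbr_sum e L (fun l' => x l' - c) l - t * (x l - c).
have phiE l : nbr_sum e L x l - t * x l = c * (D l - t) + psi l.
  suff -> : psi l = nbr_sum e L x l - D l * c - t * (x l - c) by ring.
  rewrite /psi; congr (_ - _); rewrite /D deg_sumR mulr_suml -sumrB.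
  by apply: eq_bigr => l' _; rewrite mulrBr.
have psi2 : \sum_(l in L) psi l ^+ 2 <= 4 * s ^+ 2 * P.
  have b1 : \sum_(l in L) nbr_sum e L (fun l' => x l' - c) l ^+ 2 <= s * s * P.
    apply: (le_trans (sum_sqr_nbr_sum_le _ _ _ _)); apply: ler_wpM2r => //.
    have -> : s * s = \sum_(l in L) s by rewrite sumr_const -[RHS]mulr_natr.
    rewrite natr_sum.
    by apply: ler_sum => l lL; have := Ds _ lL; rewrite /D; lra.
  have b2 : t ^+ 2 * P <= s ^+ 2 * P.
    by apply: ler_wpM2r => //; rewrite ler_sqr ?nnegrE; lra.
  apply: (@le_trans _ _ (\sum_(l in L) (2 * nbr_sum e L (fun l' => x l' - c) l ^+ 2
       + 2 * t ^+ 2 * (x l - c) ^+ 2))).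
    apply: ler_sum => l _; rewrite /psi; set y := nbr_sum _ _ _ _.
    rewrite -subr_ge0 (_ : _ - _ = (y + t * (x l - c)) ^+ 2); first exact: sqr_ge0.
    by ring.
  by rewrite big_split /= -!mulr_sumr -/P; lra.
pose r := (8 * s ^+ 2)^-1.
have s20 : 0 < 8 * s ^+ 2 by rewrite mulr_gt0 // exprn_gt0.
have r0 : 0 < r by rewrite invr_gt0.
have rs : r * (8 * s ^+ 2) = 1 by rewrite mulVf // gt_eqF.
have F2 : \sum_(l in L) (nbr_sum e L x l - t * x l) ^+ 2 <=
    c ^+ 2 * (h2 + s * t ^+ 2) + r * (s * c ^+ 2) + (8 * s ^+ 2 * s ^+ 2 + 1) * (4 * s ^+ 2 * P).
  apply: (@le_trans _ _ (\sum_(l in L) (c ^+ 2 * (D l - t) ^+ 2 + r * c ^+ 2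
      + (8 * s ^+ 2 * s ^+ 2 + 1) * psi l ^+ 2))).
    apply: ler_sum => l lL; rewrite phiE.
    have Dt : (D l - t) ^+ 2 <= s ^+ 2.
      have := D0 l; have := Ds _ lL => d1 d2.
      by rewrite -subr_ge0 subr_sqr mulr_ge0; lra.
    have am : 2 * (c * ((D l - t) * psi l)) <= r * c ^+ 2 + 8 * s ^+ 2 * ((D l - t) * psi l) ^+ 2.
      rewrite -subr_ge0 (_ : _ - _ = r * (c - (8 * s ^+ 2) * ((D l - t) * psi l)) ^+ 2).
        by rewrite mulr_ge0 ?sqr_ge0 ?ltW.
      set z := (D l - t) * psi l; set S8 := 8 * s ^+ 2 in rs *.
      have -> : r * (c - S8 * z) ^+ 2 = r * c ^+ 2 - 2 * (r * S8) * (c * z) + (r * S8) * S8 * z ^+ 2 by ring.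
      by rewrite rs; ring.
    have := ler_wpM2r (sqr_ge0 (psi l)) Dt.
    move/(ler_wpM2l (ltW s20)) => h; rewrite exprMn in am; lra.
  rewrite big_split /= big_split /= -!mulr_sumr sumr_const.
  have -> : \sum_(l in L) (D l - t) ^+ 2 = h2 + s * t ^+ 2.
    rewrite /h2 (eq_bigr (fun l => (D l - 2 * t) ^+ 2 + (2 * t * D l - 3 * t ^+ 2))); last first.
      by move=> l _; ring.
    by rewrite big_split /= sumrB -mulr_sumr SD sumr_const -[_ *+ #|_|]mulr_natl -/s; ring.
  have := ler_wpM2l (_ : 0 <= 8 * s ^+ 2 * s ^+ 2 + 1) psi2.
  have -> : 0 <= 8 * s ^+ 2 * s ^+ 2 + 1.
    by rewrite addr_ge0 // mulr_ge0 ?sqr_ge0 // ltW.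
  move/(_ isT); rewrite -[_ *+ #|_|]mulr_natl -/s; lra.
(* The cross term is split by AM-GM with weight [th = s (1 - eps)] instead of [s], which saves
   [p s eps P] to absorb the [psi] terms; [eps] is small enough for the loss in the variance term to
   stay below [r]. *)
pose eps := (16 * s ^+ 4)^-1.
have s40 : 0 < 16 * s ^+ 4 by rewrite mulr_gt0 // exprn_gt0.
have eps0 : 0 < eps by rewrite invr_gt0.
have epss : eps * (16 * s ^+ 4) = 1 by rewrite mulVf // gt_eqF.
have s4 : 1 <= s ^+ 4 by rewrite exprn_ege1.
have eps1 : eps <= 1 / 16.
  by rewrite /eps div1r lef_pV2 ?posrE //; lra.
have p0 : 0 < p by apply: lt_le_trans hp; rewrite mulr_gt0 // exprn_gt0.
pose th := s * (1 - eps).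
have th0 : 0 < th by rewrite mulr_gt0 //; lra.
have cross : 2 * (p * w) * \sum_(l in L) (D l - 2 * t) * x l <= p * w ^+ 2 * (h2 / th) + p * th * P.
  have -> : \sum_(l in L) (D l - 2 * t) * x l = \sum_(l in L) (D l - 2 * t) * (x l - c).
    apply/eqP; rewrite -subr_eq0 -sumrB (eq_bigr (fun l => c * (D l - 2 * t))); last by move=> l _; ring.
    by rewrite -mulr_sumr sumrB SD sumr_const -[_ *+ #|_|]mulr_natl -/s (mulrC s) subrr mulr0.
  have -> : p * w ^+ 2 * (h2 / th) + p * th * P =
     \sum_(l in L) p * (w ^+ 2 * ((D l - 2 * t) ^+ 2 / th) + th * (x l - c) ^+ 2).
    by rewrite -mulr_sumr big_split /= -!mulr_sumr -mulr_suml -/h2 -/P; ring.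
  rewrite mulr_sumr; apply: ler_sum => l _.
  rewrite (_ : _ * _ = p * (2 * (w * ((D l - 2 * t) * (x l - c))))); last by ring.
  apply: ler_wpM2l; first exact: ltW.
  set z := D l - 2 * t; set u := x l - c.
  rewrite -subr_ge0 (_ : _ - _ = th^-1 * (w * z - th * u) ^+ 2); last by field; rewrite gt_eqF.
  by rewrite mulr_ge0 ?sqr_ge0 // invr_ge0 ltW.
(* the variance term loses a factor [1 - eps], which the slack in [hvar] pays for *)
have hth : h2 / th <= h2 / s + r.
  rewrite ler_pdivrMr // mulrDl.
  have -> : h2 / s * th = h2 - eps * h2 by rewrite /th; field; rewrite gt_eqF.
  have h2s : h2 <= s ^+ 3 / 4.
    have : 4 * s * h2 <= s ^+ 4.
      have t2 : 0 <= s ^+ 2 * t ^+ 2 by rewrite mulr_ge0 ?sqr_ge0.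
      have : (s - 1) ^+ 2 <= s ^+ 2 by rewrite ler_sqr ?nnegrE; lra.
      by move/(ler_wpM2l (sqr_ge0 s)); lra.
    move=> h; rewrite -(ler_pM2l s0); lra.
  have e1 : eps * h2 <= eps * (s ^+ 3 / 4) by apply: ler_wpM2l => //; apply: ltW.
  have e3 : eps * s ^+ 3 = r * s / 2 by rewrite /eps /r; field; rewrite gt_eqF.
  have rth : r * (15 / 16 * s) <= r * th.
    by apply: ler_wpM2l; [exact: ltW | rewrite /th mulrC; apply: ler_wpM2l; lra].
  have rs0 : 0 <= r * s by rewrite mulr_ge0 // ltW.
  lra.
(* The requirement is [32 s ^ 6 + 4 s ^ 2 + 1 <= p s eps]. Its left side is at most [37 s ^ 6], and
   [592 = 16 * 37]. *)
have pP : (8 * s ^+ 2 * s ^+ 2 + 1) * (4 * s ^+ 2 * P) + p * th * P <= (s * p - 1) * P.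
  rewrite mulrA -mulrDl; apply: ler_wpM2r => //.
  have -> : p * th = s * p - p * (s * eps) by rewrite /th; ring.
  have : 592 * s ^+ 9 * (s * eps) <= p * (s * eps).
    by apply: ler_wpM2r => //; rewrite mulr_ge0 ?ltW.
  have -> : 592 * s ^+ 9 * (s * eps) = 37 * s ^+ 6 * (eps * (16 * s ^+ 4)) by ring.
  rewrite epss.
  have i1 : s ^+ 2 <= s ^+ 6 by rewrite ler_weXn2l.
  have i2 : 1 <= s ^+ 6 by rewrite exprn_ege1.
  lra.
have hvar2 : h2 / s + t ^+ 2 + 2 * r <= (s - 1) ^+ 2 / 4.
  rewrite -(ler_pM2r (_ : 0 < 4 * s ^+ 2)) ?mulr_gt0 ?exprn_gt0 //.
  have -> : (h2 / s + t ^+ 2 + 2 * r) * (4 * s ^+ 2) = 4 * s * h2 + 4 * s ^+ 2 * t ^+ 2 + r * (8 * s ^+ 2).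
    by field; rewrite gt_eqF.
  by rewrite rs; lra.
have g1 := ler_wpM2r (_ : 0 <= s * c ^+ 2) hvar2.
have {}g1 : (h2 / s + t ^+ 2 + 2 * r) * (s * c ^+ 2) <= (s - 1) ^+ 2 / 4 * (s * c ^+ 2).
  by apply: g1; rewrite mulr_ge0 ?sqr_ge0 // ltW.
have -> : (8 * s ^+ 2)^-1 = r by [].
have hsE : h2 / s * (s * c ^+ 2) = h2 * c ^+ 2 by field; rewrite gt_eqF.
have pw0 : 0 <= p * w ^+ 2 by rewrite mulr_ge0 ?sqr_ge0 // ltW.
have g2 := ler_wpM2r pw0 hvar2; have g3 := ler_wpM2l pw0 hth.
rewrite 2!mulrDl hsE in g1.
have rc : 0 <= r * (s * c ^+ 2).
  by apply: mulr_ge0; [exact: ltW | rewrite mulr_ge0 ?sqr_ge0 // ltW].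
rewrite -/(D _); move: cross F2; rewrite /D; lra.
Qed.

Lemma amgm (R : realFieldType) (a b tau : R) : 0 < tau -> 2 * (a * b) <= tau^-1 * a ^+ 2 + tau * b ^+ 2.
Proof.
move=> tau0; rewrite -subr_ge0 (_ : _ - _ = tau^-1 * (a - tau * b) ^+ 2).
  by rewrite mulr_ge0 ?sqr_ge0 // invr_ge0 ltW.
by field; rewrite gt_eqF.
Qed.

(** A vertex of [C] sees at most one entry [x b], whose square is at most
    [2 w ^ 2 + 2 (x b - w) ^ 2]. *)
Lemma sum_sqr_nbr_sum_sparse (R : realFieldType) T (e : rel T) (B C : {set T}) (x : T -> R) (w : R) :
  (forall c, c \in C -> (deg e B c <= 1)%N) ->
  \sum_(c in C) nbr_sum e B x c ^+ 2
    <= 2 * #|C|%:R * w ^+ 2 + 2 * #|C|%:R * \sum_(b in B) (x b - w) ^+ 2.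
Proof.
move=> dB; set Q := \sum_(b in B) _.
have -> : 2 * #|C|%:R * w ^+ 2 + 2 * #|C|%:R * Q = \sum_(c in C) 2 * (w ^+ 2 + Q).
  by rewrite sumr_const -[RHS]mulr_natl; ring.
apply: ler_sum => c cC.
have d1 : (deg e B c)%:R <= 1 :> R by rewrite lern1 dB.
have n0 : 0 <= nbr_sum e B (fun b => x b ^+ 2) c by apply: nbr_sum_ge0 => b _; apply: sqr_ge0.
apply: (le_trans (sqr_nbr_sum_le _ _ _ _)); apply: (le_trans (ler_wpM2r n0 d1)); rewrite mul1r.
apply: (@le_trans _ _ (nbr_sum e B (fun b => 2 * w ^+ 2 + 2 * (x b - w) ^+ 2) c)).
  apply: ler_sum => b _; apply: ler_wpM2l => //.
  rewrite -subr_ge0 (_ : _ - _ = (x b - 2 * w) ^+ 2); first exact: sqr_ge0.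
  by ring.
have -> : nbr_sum e B (fun b => 2 * w ^+ 2 + 2 * (x b - w) ^+ 2) c =
    2 * w ^+ 2 * (deg e B c)%:R + 2 * nbr_sum e B (fun b => (x b - w) ^+ 2) c.
  rewrite deg_sumR !mulr_sumr -big_split /=; apply: eq_bigr => b _; ring.
have h1 : 2 * w ^+ 2 * (deg e B c)%:R <= 2 * w ^+ 2.
  by rewrite -[leRHS]mulr1; apply: ler_wpM2l => //; rewrite mulr_ge0 ?sqr_ge0.
have h2 : nbr_sum e B (fun b => (x b - w) ^+ 2) c <= Q.
  by apply: nbr_sum_le => b _; apply: sqr_ge0.
lra.
Qed.

Lemma sum_sqr_sub (R : realFieldType) T (A : {set T}) (f x : T -> R) (b : R) :
  \sum_(v in A) (f v - b * x v) ^+ 2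
    <= 2 * \sum_(v in A) f v ^+ 2 + 2 * b ^+ 2 * \sum_(v in A) x v ^+ 2.
Proof.
rewrite !mulr_sumr -big_split /=; apply: ler_sum => v _.
rewrite -subr_ge0 (_ : _ - _ = (f v + b * x v) ^+ 2); first exact: sqr_ge0.
by ring.
Qed.

Lemma cross_bound (R : realFieldType) T (C : {set T}) (x y : T -> R) (a s : R) :
  0 <= a -> a <= s ->
  - (2 * a * \sum_(v in C) x v * y v)
    <= s * (\sum_(v in C) x v ^+ 2 + \sum_(v in C) y v ^+ 2).
Proof.
move=> a0 as_; rewrite -big_split /= !mulr_sumr -sumrN; apply: ler_sum => v _.
have h : - (2 * (x v * y v)) <= x v ^+ 2 + y v ^+ 2 by have := sqr_ge0 (x v + y v); lra.
have nn : 0 <= x v ^+ 2 + y v ^+ 2 by rewrite addr_ge0 // sqr_ge0.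
by have := ler_wpM2l a0 h; have := ler_wpM2r nn as_; lra.
Qed.

Lemma slack_bounds (R : realFieldType) (s p k tau c2 w2 P Qb Z : R) :
  1 <= s -> 8 <= p -> 0 <= k -> 0 <= tau -> 0 <= c2 -> 0 <= w2 -> 0 <= P -> 0 <= Qb -> 0 <= Z ->
  let slack := k / 2 * (c2 + P) + k / 2 * w2 + p / 4 * Z + s * p / 2 * Qb + P + tau * (c2 + w2) in
  0 <= slack /\ (0 < k \/ 0 < tau -> 0 < c2 + P + (w2 + Qb) + Z -> 0 < slack).
Proof.
move=> s1 p8 k0 tau0 c20 w20 P0 Q0 Z0 slack.
have q1 := mulr_ge0 k0 c20; have q2 := mulr_ge0 k0 P0; have q3 := mulr_ge0 k0 w20.
have q4 := mulr_ge0 tau0 c20; have q5 := mulr_ge0 tau0 w20.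
have q6 : 2 * Z <= p / 4 * Z by apply: ler_wpM2r => //; lra.
have q7 : 2 * Qb <= s * p / 2 * Qb.
  by apply: ler_wpM2r => //; have := ler_wpM2r (_ : 0 <= p) s1; lra.
split; first by rewrite /slack; lra.
move=> kt N0; have [cw|cw] := ltP 0 (c2 + w2); last by rewrite /slack; lra.
by case: kt => h; have := mulr_gt0 h cw; rewrite /slack; lra.
Qed.

(** For an eigenvector, [(lam - t) ^ 2 * |x| ^ 2] is the squared norm of [(A - t) x]. It is expanded
    over the rows of [L], [B] and [C], and each piece is estimated separately for [budget]; the
    slack left there gives the strict case. *)
Lemma quadratic_form_bound (R : realFieldType) T (e : rel T) (x : T -> R) (L : {set T}) (K t lam : R) :
  let B := common_nbrs e L in let C := ~: (L :|: B) in
  simple_graph e -> (0 < #|L|)%N -> {in B &, forall a b, ~~ e a b} ->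
  (forall c, c \in C -> (deg e B c <= 1)%N) ->
  (\sum_(c in C) deg e C c)%:R <= K * #|C|%:R -> 0 <= K ->
  592 * #|L|%:R ^+ 9 <= #|B|%:R :> R ->
  (80 * #|L|%:R + 76 * #|L|%:R * K) * #|C|%:R <= #|B|%:R ->
  2 * t * #|L|%:R = (\sum_(l in L) deg e L l)%:R ->
  (forall v, \sum_u (e v u)%:R * x u = lam * x v) -> (exists v, x v != 0) ->
  let bound := #|L|%:R * (#|B|%:R + #|C|%:R) + (#|L|%:R - 1) ^+ 2 / 4 in
  (lam - t) ^+ 2 <= bound /\
  (C != set0 \/ (exists a b, [/\ a \in L, b \in L, a != b & ~~ e a b]) -> (lam - t) ^+ 2 < bound).
Proof.
move=> B C [se ie] L0 indB dBC hK K0 hp hk ht ev [v0 xv0] bound.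
pose s : R := #|L|%:R; pose p : R := #|B|%:R; pose k : R := #|C|%:R.
rewrite -/s -/p -/k in hK hp hk ht *.
have s1 : 1 <= s by rewrite ler1n.
have s0 : 0 < s by lra.
have s9 : 1 <= s ^+ 9 by rewrite exprn_ege1.
have p0 : 0 < p by lra.
have k0 : 0 <= k by apply: ler0n.
have nLB l : l \in L -> l \notin B.
  by move=> lL; apply/negP => /common_nbrsP/(_ lL); rewrite ie.
have dLB : [disjoint L & B].
  by rewrite -setI_eq0; apply/eqP/setP => l; rewrite in_setI in_set0; apply/negP => /andP[/nLB/negPf->].
have dLBC : [disjoint L :|: B & C] by rewrite -setI_eq0 setICr.
have dBCd : [disjoint B & C].
  by apply: disjointWl dLBC; apply: subsetUr.
have split3 (F : T -> R) : \sum_v F v = \sum_(v in L) F v + \sum_(v in B) F v + \sum_(v in C) F v.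
  by rewrite -!big_disjointU //= setUCr; apply: eq_bigl => v; rewrite inE.
have nsplit v : lam * x v = nbr_sum e L x v + nbr_sum e B x v + nbr_sum e C x v.
  by rewrite -ev split3.
pose Us := \sum_(l in L) x l; pose W := \sum_(b in B) x b.
pose c := Us / s; pose w := W / p.
have UE : Us = s * c by rewrite /c mulrC divfK // gt_eqF.
have WE : W = p * w by rewrite /w mulrC divfK // gt_eqF.
pose P := \sum_(l in L) (x l - c) ^+ 2; pose Qb := \sum_(b in B) (x b - w) ^+ 2.
pose Z := \sum_(v in C) x v ^+ 2.
have P0 : 0 <= P by apply: sumr_ge0 => l _; apply: sqr_ge0.
have Q0 : 0 <= Qb by apply: sumr_ge0 => l _; apply: sqr_ge0.
have Z0 : 0 <= Z by apply: sumr_ge0 => l _; apply: sqr_ge0.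
have PLE : \sum_(l in L) x l ^+ 2 = s * c ^+ 2 + P by apply: sum_sqr_mean.
have QBE : \sum_(b in B) x b ^+ 2 = p * w ^+ 2 + Qb by apply: sum_sqr_mean.
set PL := s * c ^+ 2 + P in PLE.
have PL0 : 0 <= PL by rewrite -PLE; apply: sumr_ge0 => l _; apply: sqr_ge0.
pose f := nbr_sum e L x; pose g := nbr_sum e C x; pose bt := nbr_sum e B x.
have yL l : l \in L -> lam * x l = f l + W + g l.
  move=> lL; rewrite nsplit; congr (_ + _ + _); apply: eq_bigr => b bB.
  by rewrite (common_nbrsP bB lL) mul1r.
have yB b : b \in B -> lam * x b = Us + g b.
  move=> bB; rewrite nsplit [nbr_sum e B x b]big1 ?addr0.
    by congr (_ + _); apply: eq_bigr => l lL; rewrite se (common_nbrsP bB lL) mul1r.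
  by move=> b' b'B; rewrite (negPf (indB _ _ bB b'B)) mul0r.
have degle l : l \in L -> (deg e L l)%:R <= s.
  by move=> _; rewrite /s ler_nat; apply: subset_leq_card; apply/subsetP => z; rewrite inE => /andP[].
have t0 : 0 <= 2 * t by rewrite -(pmulr_lge0 _ s0) ht.
have sumL1 (a : R) : \sum_(l in L) a = s * a by rewrite sumr_const -mulr_natl.
have sumB1 (a : R) : \sum_(l in B) a = p * a by rewrite sumr_const -mulr_natl.
have sumC1 (a : R) : \sum_(l in C) a = k * a by rewrite sumr_const -mulr_natl.
have ts : 2 * t <= s - 1.
  rewrite -(ler_pM2r s0) ht mulrC -sumL1 natr_sum; apply: ler_sum => l lL.
  have := deg_le_card_pred ie lL; rewrite -(ler_nat R).
  by rewrite -subn1 natrB.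
have ts' : 2 * t <= s by apply: le_trans ts _; rewrite lerBlDr lerDl.
have t'0 : 0 <= t by rewrite -(pmulr_rge0 t (ltr0Sn R 1)).
have t2 : t ^+ 2 <= (s - 1) ^+ 2 / 4.
  rewrite ler_pdivlMr // (_ : t ^+ 2 * 4 = (2 * t) ^+ 2); last by ring.
  by rewrite ler_sqr ?nnegrE // subr_ge0.
have t2s : (2 * t) ^+ 2 <= s ^+ 2 by rewrite ler_sqr ?nnegrE // ltW.
pose F2 := \sum_(l in L) (f l - t * x l) ^+ 2.
pose X := \sum_(l in L) ((deg e L l)%:R - 2 * t) * x l.
pose G2 := \sum_(l in L) g l ^+ 2; pose Gs := \sum_(l in L) g l.
pose FG := \sum_(l in L) (f l - 2 * t * x l) * g l.
pose H1 := \sum_(b in B) g b; pose H2 := \sum_(b in B) g b ^+ 2.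
pose V2 := \sum_(v in C) f v ^+ 2; pose VE := \sum_(v in C) f v * (bt v + g v).
pose E2 := \sum_(v in C) (bt v + g v) ^+ 2.
pose XB := \sum_(v in C) x v * bt v; pose XG := \sum_(v in C) x v * g v.
pose B2 := \sum_(v in C) bt v ^+ 2; pose C2 := \sum_(v in C) g v ^+ 2.
have Sf : \sum_(l in L) f l = X + 2 * t * Us.
  rewrite /f sum_nbr_sum // /X /Us mulr_sumr -big_split /=.
  by apply: eq_bigr => l _; ring.
(* The terms in [t * Us * W] and in [t * \sum x v * f v] appear with opposite signs in [SB] and [SC]
   and cancel in the total. *)
have SL : \sum_(l in L) (lam * x l - t * x l) ^+ 2 =
    F2 + s * W ^+ 2 + G2 + 2 * W * (X + t * Us) + 2 * (FG + t * \sum_(v in C) x v * f v) + 2 * W * Gs.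
  have -> : \sum_(v in C) x v * f v = \sum_(l in L) x l * g l by rewrite (nbr_sum_sym C L x x se).
  rewrite (eq_bigr (fun l => (f l - t * x l) ^+ 2 + W ^+ 2 + g l ^+ 2 + 2 * W * f l
    + (- (2 * W * t)) * x l + 2 * ((f l - 2 * t * x l) * g l) + 2 * t * (x l * g l) + 2 * W * g l)).
    by rewrite !big_split /= -!mulr_sumr sumL1 Sf -/F2 -/G2 -/FG -/Gs -/Us; ring.
  by move=> l lL; rewrite yL //; ring.
have SB : \sum_(b in B) (lam * x b - t * x b) ^+ 2 =
    p * Us ^+ 2 + 2 * Us * H1 + H2 + t ^+ 2 * (p * w ^+ 2 + Qb) - 2 * t * Us * W - 2 * t * XB.
  have -> : XB = \sum_(b in B) x b * g b by rewrite (nbr_sum_sym B C x x se).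
  rewrite -QBE (eq_bigr (fun b => Us ^+ 2 + 2 * Us * g b + g b ^+ 2 + t ^+ 2 * x b ^+ 2
    + (- (2 * t * Us)) * x b + (- (2 * t)) * (x b * g b))).
    by rewrite !big_split /= -!mulr_sumr sumB1 -/H1 -/H2 -/W; ring.
  by move=> b bB; rewrite yB //; ring.
have SC : \sum_(v in C) (lam * x v - t * x v) ^+ 2 =
    V2 + 2 * VE + E2 + t ^+ 2 * Z - 2 * t * \sum_(v in C) x v * f v - 2 * t * XB - 2 * t * XG.
  rewrite (eq_bigr (fun v => f v ^+ 2 + 2 * (f v * (bt v + g v)) + (bt v + g v) ^+ 2
    + t ^+ 2 * x v ^+ 2 + (- (2 * t)) * (x v * f v) + (- (2 * t)) * (x v * bt v)
    + (- (2 * t)) * (x v * g v))).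
    by rewrite !big_split /= -!mulr_sumr -/V2 -/VE -/E2 -/Z -/XB -/XG; ring.
  by move=> v vC; rewrite nsplit -/(f v) -/(g v) -/(bt v); ring.
have hG2 : G2 <= s * k * Z.
  apply: (le_trans (sum_sqr_nbr_sum_le _ _ _ _)); apply: ler_wpM2r => //.
  rewrite natr_sum -sumL1; apply: ler_sum => l _.
  by rewrite ler_nat; apply: subset_leq_card; apply/subsetP => z; rewrite inE => /andP[].
(* A vertex of [C] is not a common neighbour, so it misses some [l]. The resulting [s - 1] in place
   of [s] is the source of the slack proportional to [k]. *)
have dLC v : v \in C -> (deg e L v)%:R <= s - 1.
  move=> vC; have [l lL nlv] : exists2 l, l \in L & ~~ e l v.
    by apply/forall_inPn; move: vC; rewrite !inE negb_or => /andP[].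
  have sub : nbrs e L v \subset L :\ l.
    apply/subsetP => z; rewrite in_set => /andP[zL evz]; rewrite in_setD1 zL andbT.
    by apply: contraNneq nlv => <-; rewrite se.
  have := subset_leq_card sub; rewrite -(ler_nat R) -/(deg e L v).
  have -> : s = 1 + #|L :\ l|%:R by rewrite /s (cardsD1 l L) lL natrD.
  lra.
have hGs : 2 * (p * w) * Gs <= (s - 1) * (k * p * w ^+ 2 + p * Z).
  rewrite /Gs /g sum_nbr_sum //.
  have pV : 0 < p^-1 by rewrite invr_gt0.
  have := @wsum_amgm R T C (fun v => (deg e L v)%:R) x (s - 1) (p * w) p^-1 pV.
  rewrite invrK -/k -/Z (_ : p^-1 * k * (p * w) ^+ 2 = k * p * w ^+ 2); last by field; rewrite gt_eqF.
  by apply=> v vC; rewrite ler0n dLC.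
have hV2 : V2 <= (s - 1) * k * PL.
  apply: (le_trans (sum_sqr_nbr_sum_le _ _ _ _)); rewrite PLE; apply: ler_wpM2r => //.
  by rewrite natr_sum mulrC -sumC1; apply: ler_sum => v; apply: dLC.
have hH1 : 2 * (s * c) * H1 <= k * PL / 8 + 8 * s * Z.
  rewrite /H1 /g sum_nbr_sum //.
  have tau0 : 0 < (8 * s)^-1 by rewrite invr_gt0 mulr_gt0.
  have := @wsum_amgm R T C (fun v => (deg e B v)%:R) x 1 (s * c) (8 * s)^-1 tau0.
  rewrite invrK mul1r -/k -/Z => /(_ _)/le_trans; apply.
    by move=> v vC; rewrite ler0n lern1 dBC.
  rewrite lerD2r (_ : _ * _ = k * (s * c ^+ 2) / 8); last by field; rewrite gt_eqF.
  by have := mulr_ge0 k0 P0; rewrite /PL; clear; lra.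
have hH2 : H2 <= k * Z.
  apply: (le_trans (sum_sqr_nbr_sum_le _ _ _ _)); apply: ler_wpM2r => //.
  rewrite (sum_deg_sym _ _ se) -[leRHS]mulr1 -sumC1 natr_sum; apply: ler_sum => v vC.
  by rewrite lern1 dBC.
have hVE : 2 * VE <= k * PL / 8 + 8 * s * E2.
  apply: (@le_trans _ _ ((8 * s)^-1 * V2 + 8 * s * E2)).
    rewrite /VE /V2 /E2 !mulr_sumr -big_split /=; apply: ler_sum => v _.
    by apply: amgm; rewrite mulr_gt0.
  rewrite lerD2r ler_pdivrMl ?mulr_gt0 //; apply: (le_trans hV2).
  by have := mulr_ge0 k0 PL0; clear; lra.
have hE2 : E2 <= 2 * B2 + 2 * C2.
  have -> : E2 = \sum_(v in C) (bt v - -1 * g v) ^+ 2 by apply: eq_bigr => v _; ring.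
  by have := sum_sqr_sub C bt g (-1); rewrite sqrrN expr1n mulr1.
have hC2 : C2 <= K * k * Z.
  by apply: (le_trans (sum_sqr_nbr_sum_le _ _ _ _)); apply: ler_wpM2r.
have hB2 : B2 <= 2 * k * w ^+ 2 + 2 * k * Qb by apply: sum_sqr_nbr_sum_sparse.
have hXB : - (4 * t * XB) <= s * (Z + B2).
  by rewrite (_ : 4 * t = 2 * (2 * t)); [apply: cross_bound | ring].
have hXG : - (2 * t * XG) <= s * (Z + C2).
  by apply: cross_bound => //; apply: le_trans ts'; rewrite mulr_natl mulrS lerDl.
have hFG : 2 * FG <= k * PL / 8 + 32 * s ^+ 3 * Z.
  pose a l := f l - 2 * t * x l.
  (* The AM-GM weight: [32 s ^ 2 = 8 * 4 s ^ 2] turns the bound [4 s ^ 2 * PL] of [Sa] into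
     [k * PL / 8]. *)
  have s2 : 0 < 32 * s ^+ 2 by rewrite mulr_gt0 // exprn_gt0.
  have Sa : \sum_(l in L) a l ^+ 2 <= 4 * s ^+ 2 * PL.
    have b1 : \sum_(l in L) f l ^+ 2 <= s * s * PL.
      apply: (le_trans (sum_sqr_nbr_sum_le _ _ _ _)); rewrite PLE; apply: ler_wpM2r => //.
      by rewrite -sumL1 natr_sum; apply: ler_sum => l; apply: degle.
    have b2 : (2 * t) ^+ 2 * PL <= s ^+ 2 * PL by apply: ler_wpM2r.
    apply: (le_trans (sum_sqr_sub L f x (2 * t))); rewrite PLE.
    move: b1 b2; clear; lra.
  apply: (@le_trans _ _ (\sum_(l in L) ((32 * s ^+ 2)^-1 * k * a l ^+ 2 + 32 * s ^+ 2 * Z))).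
    rewrite /FG mulr_sumr; apply: ler_sum => l _; rewrite mulrA.
    have tau0 : 0 < (32 * s ^+ 2)^-1 by rewrite invr_gt0.
    by have := nbr_sum_amgm e C x l (a l) tau0; rewrite invrK.
  rewrite big_split /= sumL1 -mulr_sumr; apply: lerD; last by lra.
  have kk : 0 <= (32 * s ^+ 2)^-1 * k by rewrite mulr_ge0 // invr_ge0 ltW.
  apply: (le_trans (ler_wpM2l kk Sa)).
  by rewrite le_eqVlt; apply/orP; left; apply/eqP; field; rewrite gt_eqF.
have s39 : s ^+ 3 <= s ^+ 9 by rewrite ler_weXn2l.
have s19 : s <= s ^+ 9 by rewrite -[leLHS]expr1 ler_weXn2l.
(* [tau] measures the gain on [L]: zero for a clique, [1 / (8 s ^ 2)] otherwise. *)
have [tau [tau0 taupos star]] : exists tau : R, [/\ 0 <= tau,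
    (exists a b, [/\ a \in L, b \in L, a != b & ~~ e a b]) -> 0 < tau &
  F2 + 2 * (p * w) * X + tau * (s * c ^+ 2 + p * w ^+ 2) <=
    (s - 1) ^+ 2 / 4 * (s * c ^+ 2) + ((s - 1) ^+ 2 / 4 - t ^+ 2) * (p * w ^+ 2) + (s * p - 1) * P].
  have [cl|] := boolP [forall a in L, forall b in L, (a != b) ==> e a b].
    have cl' : {in L &, forall a b, a != b -> e a b}.
      by move=> a b aL bL; apply/implyP; move/forall_inP/(_ a aL)/forall_inP/(_ b bL): cl.
    exists 0; split=> //.
      by move=> [a [b [aL bL ab]]]; rewrite cl'.
    by rewrite mul0r addr0; apply: induced_form_clique => //; rewrite -/s; lra.
  move=> /forall_inPn[a aL /forall_inPn[b bL]]; rewrite negb_imply => /andP[ab neab].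
  exists (8 * s ^+ 2)^-1; split.
  - by rewrite invr_ge0 mulr_ge0 // sqr_ge0.
  - by move=> _; rewrite invr_gt0 mulr_gt0 // exprn_gt0.
  exact: (induced_form_nonclique (a := a) (b := b)).
have main := @budget R s p k K t tau c w P Qb Z F2 X G2 FG Gs H1 H2 V2 VE E2 XB XG B2 C2
  s1 k0 K0 _ hk P0 Q0 Z0 t2 star hG2 hGs hV2 hH1 hH2 hVE hE2 hC2 hB2 hXB hXG hFG.
have {}main := main (_ : 168 * s ^+ 3 <= p).
pose N := \sum_v x v ^+ 2.
have NE : N = PL + (p * w ^+ 2 + Qb) + Z by rewrite /N split3 PLE QBE.
pose slack := k / 2 * (s * c ^+ 2 + P) + k / 2 * (p * w ^+ 2) + p / 4 * Z + s * p / 2 * Qb + P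
       + tau * (s * c ^+ 2 + p * w ^+ 2).
have SN : (lam - t) ^+ 2 * N + slack <= bound * N.
  have -> : (lam - t) ^+ 2 * N = \sum_v (lam * x v - t * x v) ^+ 2.
    by rewrite mulr_sumr; apply: eq_bigr => v _; rewrite -mulrBl exprMn.
  rewrite split3 SL SB SC NE; have := main _; rewrite -/slack -UE -WE /PL /bound.
  by rewrite -/s -/p -/k => /(_ _); lra.
have N0 : 0 < N.
  rewrite lt_def sumr_ge0 ?andbT; last by move=> v _; apply: sqr_ge0.
  rewrite psumr_eq0; last by move=> v _; apply: sqr_ge0.
  by apply/allPn; exists v0; rewrite ?mem_index_enum // sqrf_eq0.
have sc0 : 0 <= s * c ^+ 2 by apply: mulr_ge0; [exact: ltW | exact: sqr_ge0].
have pw0 : 0 <= p * w ^+ 2 by apply: mulr_ge0; [exact: ltW | exact: sqr_ge0].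
have p8 : 8 <= p by apply: le_trans hp; rewrite -[leLHS]mulr1; apply: ler_pM; rewrite ?ler_nat.
have [slack0 slackpos] := slack_bounds s1 p8 k0 tau0 sc0 pw0 P0 Q0 Z0.
split; first by rewrite -(ler_pM2r N0); apply: le_trans SN; rewrite lerDl.
move=> strict; rewrite -(ltr_pM2r N0); apply: lt_le_trans SN; rewrite ltrDl slackpos //.
  by case: strict => [C0|/taupos]; [left; rewrite ltr0n card_gt0 | right].
by rewrite -/PL -NE.
Qed.

(** * Eigenvalues and spread *)

Lemma mem_eigenvalues (R : rcfType) n (A : 'M[R]_n) (a : R) :
  (a \in eigenvalues A) = eigenvalue A a.
Proof.
have := roots_on_rootsR (monic_neq0 (char_poly_monic A)) a.
by rewrite eigenvalue_root_char inE.
Qed.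

Lemma eigenvalue_adjmxP (R : rcfType) n (e : rel 'I_n) (a : R) : symmetric e ->
  reflect (exists2 x : 'I_n -> R, forall v, \sum_w (e v w)%:R * x w = a * x v & exists v, x v != 0)
          (eigenvalue (adjmx R e) a).
Proof.
move=> se; apply: (iffP eigenvalueP) => [[v vA v0]|[x xA [u xu]]].
  exists (v ord0).
    move=> j; have /rowP/(_ j) := vA; rewrite !mxE => <-.
    by apply: eq_bigr => i _; rewrite mxE se mulrC.
  by have /rV0Pn[j vj] := v0; exists j.
exists (\row_i x i).
  apply/rowP => j; rewrite !mxE -xA; apply: eq_bigr => i _.
  by rewrite !mxE se mulrC.
by apply/rV0Pn; exists u; rewrite mxE.
Qed.

Lemma eigenvalues_bounds (R : rcfType) n (A : 'M[R]_n) (a : R) :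
  a \in eigenvalues A -> lambda_min A <= a <= lambda_max A.
Proof.
have : sorted <%R (eigenvalues A) by apply: sorted_roots.
rewrite /lambda_min /lambda_max; case: (eigenvalues A) => // b s /= pbs ain.
apply/andP; split.
  move: ain; rewrite inE => /orP[/eqP->//|]; move: (order_path_min lt_trans pbs).
  by move=> /allP h /h /ltW.
elim: s a b pbs ain => [|d s IHs] a b /=; first by rewrite inE => _ /eqP->.
move=> /andP[bd pds]; rewrite inE => /orP[/eqP->|]; last exact: IHs.
by apply: le_trans (ltW bd) _; apply: IHs => //; apply: mem_head.
Qed.

Lemma eigenvalues_ends (R : rcfType) n (A : 'M[R]_n) :
  eigenvalues A != [::] -> lambda_min A \in eigenvalues A /\ lambda_max A \in eigenvalues A.
Proof.
rewrite /lambda_min /lambda_max; case: (eigenvalues A) => // b s _ /=.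
by rewrite mem_head mem_last.
Qed.

(** If the list of eigenvalues were empty, both ends would take the default [0] and the spread would
    vanish. Positivity thus yields real eigenvectors without the spectral theorem. *)
Lemma spread_eigenvectors (R : rcfType) n (e : rel 'I_n) : symmetric e -> 0 < spread R e ->
  (exists2 x : 'I_n -> R, forall v, \sum_w (e v w)%:R * x w = lambda_max (adjmx R e) * x v
     & exists v, x v != 0) /\
  (exists2 x : 'I_n -> R, forall v, \sum_w (e v w)%:R * x w = lambda_min (adjmx R e) * x v
     & exists v, x v != 0).
Proof.
move=> se; have [E|/eigenvalues_ends[h1 h2] _] := eqVneq (eigenvalues (adjmx R e)) [::].
  by rewrite /spread /lambda_max /lambda_min E subrr ltxx.
by split; apply/(eigenvalue_adjmxP _ se); rewrite -mem_eigenvalues.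
Qed.

(** * Clique joins and the extremal graph *)

Definition is_clique_join T (e : rel T) (L : {set T}) : Prop :=
  [/\ {in L &, forall a b, a != b -> e a b}, {in ~: L &, forall a b, ~~ e a b} &
      forall a b, a \in L -> b \notin L -> e a b].

(** Vectors constant on [L] and off [L] exhibit [t + sigma / 2] and [t - sigma / 2] as eigenvalues.
    That no eigenvalue lies beyond them is [quadratic_form_bound] with [C] empty, whence the lower
    bound on [#|~: L|]. *)
Lemma clique_join_spread (R : rcfType) n (e : rel 'I_n) (L : {set 'I_n}) (sigma : R) :
  simple_graph e -> is_clique_join e L -> (0 < #|L|)%N ->
  (592 * #|L| ^ 9 <= #|~: L|)%N -> 0 <= sigma ->
  sigma ^+ 2 = 4 * #|L|%:R * #|~: L|%:R + (#|L|%:R - 1) ^+ 2 ->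
  spread R e = sigma.
Proof.
move=> sg [cL iL jL] L0 big sig0 sigE; have [se ie] := sg.
set s : R := #|L|%:R in sigE; set m : R := #|~: L|%:R in sigE.
have s1 : 1 <= s by rewrite ler1n.
pose t := (s - 1) / 2.
have BE : common_nbrs e L = ~: L.
  apply/setP => v; rewrite inE; apply/idP/idP => [vB|vL].
    by rewrite inE; apply/negP => vL; move/forall_inP/(_ v vL): vB; rewrite ie.
  by apply/forall_inP => l lL; apply: jL => //; rewrite inE in vL.
have CE : ~: (L :|: common_nbrs e L) = set0 by rewrite BE setUCr setCT.
have s9 : 592 * s ^+ 9 <= m.
  by rewrite -natrX -natrM ler_nat.
have tE : 2 * t * #|L|%:R = (\sum_(l in L) deg e L l)%:R.
  rewrite natr_sum -/s (_ : 2 * t * s = \sum_(l in L) (s - 1)).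
    apply: eq_bigr => l lL; have := deg_compl ie lL.
    rewrite [X in (_ + X)%N](_ : _ = 0)%N ?addn0 => [->|].
      by rewrite -subn1 natrB.
    apply/eqP; rewrite cards_eq0; apply/eqP/setP => v; rewrite !inE.
    case vL: (v \in L) => //=; have [//|lv] := eqVneq l v.
    by rewrite cL.
  by rewrite sumr_const -mulr_natl -/s /t; field.
have cert lam : lam \in eigenvalues (adjmx R e) -> (lam - t) ^+ 2 <= (sigma / 2) ^+ 2.
  rewrite mem_eigenvalues => /(eigenvalue_adjmxP _ se)[x xE x0].
  have := @quadratic_form_bound R _ e x L 0 t lam sg L0.
  rewrite BE setUCr setCT cards0 big_set0 -/s -/m !mulr0 addr0.
  move=> /(_ iL _ _ _ s9 _ tE xE x0)[||||h _] //; first by move=> c; rewrite inE.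
  by apply: le_trans h _; rewrite exprMn sigE; lra.
(* With values [lam] on [L] and [s] off it, the rows off [L] hold identically and those of [L]
   reduce to the quadratic equation of [mem]. *)
pose ev (lam : R) (v : 'I_n) : R := if v \in L then lam else s.
have mem lam : lam ^+ 2 = (s - 1) * lam + s * m -> lam \in eigenvalues (adjmx R e).
  move=> lamE; rewrite mem_eigenvalues; apply/(eigenvalue_adjmxP _ se); exists (ev lam).
    move=> v; rewrite (bigID (mem L)) /=.
    have -> : \sum_(i in L) (e v i)%:R * ev lam i = (deg e L v)%:R * lam.
      by rewrite deg_sumR mulr_suml; apply: eq_bigr => i iL'; rewrite /ev iL'.
    have -> : \sum_(i | i \notin L) (e v i)%:R * ev lam i = (deg e (~: L) v)%:R * s.
      rewrite deg_sumR mulr_suml; apply: eq_big => i; first by rewrite inE.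
      by rewrite /ev => /negPf->.
    rewrite /ev; case: ifPn => vL.
      have -> : (deg e (~: L) v)%:R = m.
        congr (_%:R); apply: eq_card => w; rewrite !inE.
        by case wL: (w \in L) => //=; rewrite jL ?wL.
      have -> : (deg e L v)%:R = s - 1.
        rewrite /s (cardsD1 v L) vL natrD [true%:R + _]addrC addrK; congr (_%:R).
        apply: eq_card => w; rewrite !inE andbC; have [->|ne] := eqVneq w v; first by rewrite ie.
        by case wL : (w \in L); rewrite ?andbF // cL // eq_sym.
      by move: lamE; rewrite expr2; lra.
    have -> : (deg e (~: L) v)%:R = 0 :> R.
      apply/eqP; rewrite pnatr_eq0 cards_eq0; apply/eqP/setP => w; rewrite !inE.
      by case wL: (w \in L) => //=; apply/negbTE/iL; rewrite inE ?wL.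
    have -> : (deg e L v)%:R = s.
      congr (_%:R); apply: eq_card => w; rewrite !inE.
      by case wL: (w \in L) => //=; rewrite se jL.
    by rewrite mul0r addr0 mulrC.
  have m0 : (0 < #|~: L|)%N by apply: leq_trans big; rewrite muln_gt0 expn_gt0 L0.
  by have /card_gt0P[v] := m0; rewrite inE => vL; exists v; rewrite /ev (negPf vL) gt_eqF //; lra.
have m1 : t + sigma / 2 \in eigenvalues (adjmx R e).
  by apply: mem; rewrite /t; move: sigE; lra.
have m2 : t - sigma / 2 \in eigenvalues (adjmx R e).
  by apply: mem; rewrite /t; move: sigE; lra.
have := eigenvalues_bounds m1; have := eigenvalues_bounds m2.
have [] := @eigenvalues_ends _ _ (adjmx R e).
  by apply: contraTneq m1 => ->.
move=> /cert c1 /cert c2.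
have sq (y : R) : y ^+ 2 <= (sigma / 2) ^+ 2 -> - (sigma / 2) <= y <= sigma / 2.
  by rewrite -ler_norml -(ler_sqr (x := `|y|)) ?nnegrE ?divr_ge0 // real_normK ?num_real.
move: c1 c2 => /sq/andP[a1 a2] /sq/andP[b1 b2] /andP[d1 d2] /andP[f1 f2].
by rewrite /spread; apply/eqP; rewrite eq_le; apply/andP; split; lra.
Qed.

Lemma clique_join_iso T (e : rel T) (L : {set T}) (s m : nat) :
  simple_graph e -> is_clique_join e L -> #|L| = s -> #|~: L| = m ->
  graph_iso e (graph_join (complete_graph s) (empty_graph m)).
Proof.
move=> [se ie] [cL iL jL] sE mE; subst s m.
pose g (i : 'I_#|L| + 'I_#|~: L|) : T :=
  match i with inl i => enum_val i | inr i => enum_val i end.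
have gL i : g (inl i) \in L by apply: enum_valP.
have gC i : g (inr i) \in ~: L by apply: enum_valP.
have gI : injective g.
  move=> [i|i] [j|j] E; first by rewrite (enum_val_inj E).
  - by move: (gC j); rewrite -E inE gL.
  - by move: (gC i); rewrite E inE gL.
  - by rewrite (enum_val_inj E).
have card : (#|T| <= #|{: 'I_#|L| + 'I_#|~: L|}|)%N by rewrite card_sum !card_ord cardsC.
have [h gK hK] := inj_card_bij gI card.
exists h; split; first by exists g.
move=> x y; rewrite -{2}[x]hK -{2}[y]hK.
case: (h x) (h y) => [i|i] [j|j] /=; rewrite /complete_graph /empty_graph.
- have [->|ij] := eqVneq i j; first by rewrite ie.
  by rewrite cL ?enum_valP // (inj_eq enum_val_inj).
- by rewrite jL ?enum_valP //; move: (gC j); rewrite inE.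
- by rewrite se jL ?enum_valP //; move: (gC i); rewrite inE.
- by apply/esym/negbTE/iL; apply: enum_valP.
Qed.

Lemma iso_clique_join T (e : rel T) (s m : nat) :
  graph_iso e (graph_join (complete_graph s) (empty_graph m)) ->
  exists L : {set T}, [/\ is_clique_join e L, #|L| = s & #|~: L| = m].
Proof.
move=> [h [hbij hE]]; have hI := bij_inj hbij.
pose isl (z : 'I_s + 'I_m) := if z is inl _ then true else false.
pose L := [set x | isl (h x)].
have LP x : (x \in L) = isl (h x) by rewrite inE.
exists L; split.
- split=> [a b|a b|a b]; rewrite ?in_setC !LP -hE.
  + case Ea: (h a) => [i|] // ; case Eb: (h b) => [j|] // _ _ ab /=.
    by rewrite /complete_graph; apply: contraNneq ab => E; rewrite -(inj_eq hI) Ea Eb E.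
  + by case: (h a) => // i; case: (h b).
  + by case: (h a) => // i; case: (h b).
- rewrite -[RHS]card_ord -(card_imset _ hI).
  rewrite -(card_imset 'I_s (inl_inj (B := 'I_m))); apply: eq_card => z.
  apply/imsetP/imsetP => [[x]|[i _ ->]].
    by rewrite LP; case: (h x) => // i _ ->; exists i.
  have [g gK hK] := hbij; exists (g (inl i)); rewrite ?LP hK //.
- rewrite -[RHS]card_ord -(card_imset _ hI).
  rewrite -(card_imset 'I_m (inr_inj (A := 'I_s))); apply: eq_card => z.
  apply/imsetP/imsetP => [[x]|[i _ ->]].
    by rewrite in_setC LP; case: (h x) => // i _ ->; exists i.
  have [g gK hK] := hbij; exists (g (inr i)); rewrite ?in_setC ?LP hK //.
Qed.

(** One extreme eigenvalue suffices to find [L], but the resulting structure then confines both to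
    within [sigma / 2] of the same [t]. A spread of at least [sigma] is therefore possible only in
    the equality case. *)
Lemma extremal_structure (s : nat) : (0 < s)%N ->
  exists n0 : nat, forall (R : rcfType) n (e : rel 'I_n) (sigma : R),
    (n0 <= n)%N -> simple_graph e -> ~ clique_model e s.+2 ->
    0 < sigma -> sigma ^+ 2 = 4 * s%:R * (n%:R - s%:R) + (s%:R - 1) ^+ 2 ->
    sigma <= spread R e ->
    exists L : {set 'I_n}, is_clique_join e L /\ #|L| = s.
Proof.
move=> s0; pose K := (2 ^ s.+2)%N.
(* The summands serve the lower bound on [#|B|], the comparison of [#|C|] with [#|B|], and the
   [s + 2] common neighbours that the clique models use. *)
pose M := (592 * s ^ 9 + (80 * s + 76 * s * K) + s.+2)%N.
have [n0 Hn0] := eigenvector_common_nbrs M s0.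
exists n0 => R n e sigma big sg noK sig0 sigE spr; have [se ie] := sg.
have spr0 : 0 < spread R e by apply: lt_le_trans spr.
have [[x xE x0] [y yE y0]] := spread_eigenvectors se spr0.
set l1 := lambda_max (adjmx R e) in xE; set ln := lambda_min (adjmx R e) in yE.
have sprE : spread R e = l1 - ln by [].
have lam_big (lam : R) : sigma / 2 <= `|lam| -> s%:R * (#|'I_n|%:R - s%:R) <= lam ^+ 2.
  move=> h; rewrite card_ord.
  have : (sigma / 2) ^+ 2 <= lam ^+ 2.
    by rewrite -(real_normK (num_real lam)) ler_sqr ?nnegrE // divr_ge0 // ltW.
  by rewrite exprMn sigE; have := sqr_ge0 (s%:R - 1 : R); lra.
have [L [cL MB MC]] : exists L : {set 'I_n}, [/\ #|L| = s, (M <= #|common_nbrs e L|)%N &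
      (M * #|~: (L :|: common_nbrs e L)| <= #|common_nbrs e L|)%N].
  have cn : (n0 <= #|'I_n|)%N by rewrite card_ord.
  have [h|h] := leP (sigma / 2) `|l1|.
    exact: (Hn0 R _ e x l1 cn sg noK xE x0 (lam_big _ h)).
  apply: (Hn0 R _ e y ln cn sg noK yE y0 (lam_big _ _)).
  have := ler_norm l1; have := ler_norm (- ln); rewrite normrN; move: sprE spr h; clear; lra.
set B := common_nbrs e L in MB MC; set C := ~: (L :|: B) in MC.
have s1 : 1 <= s%:R :> R by rewrite ler1n.
have sB : (s.+2 <= #|B|)%N by apply: leq_trans MB; apply: leq_addl.
have indB : {in B &, forall a b, ~~ e a b} by apply: common_nbrs_indep sg noK cL sB.
have dBC c : c \in C -> (deg e B c <= 1)%N.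
  rewrite !inE negb_or => /andP[cNL cNB]; apply: (common_nbrs_degree sg noK cL sB cNL).
  by rewrite inE.
have hK : (\sum_(c in C) deg e C c)%:R <= K%:R * #|C|%:R :> R.
  by rewrite -natrM ler_nat; apply: arcs_bound.
have hp : 592 * #|L|%:R ^+ 9 <= #|B|%:R :> R.
  rewrite cL -natrX -natrM ler_nat; apply: leq_trans MB.
  by rewrite /M -addnA leq_addr.
have hk : (80 * #|L|%:R + 76 * #|L|%:R * K%:R) * #|C|%:R <= #|B|%:R :> R.
  rewrite cL -[76 * _]natrM -[(76 * s)%:R * _]natrM -[80 * _]natrM -natrD -natrM ler_nat.
  apply: leq_trans MC; rewrite leq_mul2r; apply/orP; right.
  by rewrite /M -addnA addnCA leq_addr.
pose t : R := (\sum_(l in L) deg e L l)%:R / (2 * s%:R).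
have tE : 2 * t * #|L|%:R = (\sum_(l in L) deg e L l)%:R.
  by rewrite cL /t; field; rewrite gt_eqF //; lra.
have L0 : (0 < #|L|)%N by rewrite cL.
have [b1 st1] := quadratic_form_bound sg L0 indB dBC hK (ler0n _ _) hp hk tE xE x0.
have [bn stn] := quadratic_form_bound sg L0 indB dBC hK (ler0n _ _) hp hk tE yE y0.
have nE : n%:R = s%:R + #|B|%:R + #|C|%:R :> R.
  have dLB : [disjoint L & B].
    rewrite -setI_eq0; apply/eqP/setP => l; rewrite in_setI in_set0; apply/negP => /andP[lL].
    by move=> /common_nbrsP/(_ lL); rewrite ie.
  rewrite -cL -natrD -natrD; congr (_%:R).
  have := cardsC (L :|: B); rewrite -/C card_ord cardsU (disjoint_setI0 dLB) cards0 subn0.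
  by move=> ->.
have boundE : #|L|%:R * (#|B|%:R + #|C|%:R) + (#|L|%:R - 1) ^+ 2 / 4 = (sigma / 2) ^+ 2.
  by rewrite exprMn sigE cL nE; field.
rewrite boundE in b1 st1 bn stn.
have sg2 : 0 <= sigma / 2 by rewrite divr_ge0 // ltW.
(* Otherwise both extreme eigenvalues are strictly within [sigma / 2] of [t], and their difference
   falls below [sigma]. *)
have nostrict : ~ (C != set0 \/ (exists a b, [/\ a \in L, b \in L, a != b & ~~ e a b])).
  move=> strict.
  have lt (z : R) : z ^+ 2 < (sigma / 2) ^+ 2 -> `|z| < sigma / 2.
    by rewrite -(real_normK (num_real z)) ltr_sqr ?nnegrE.
  have /lt := st1 strict; have /lt := stn strict; rewrite !ltr_norml => /andP[h1 _] /andP[_ h2].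
  move: spr; rewrite sprE; move: h1 h2; clear; lra.
have C0 : C = set0 by apply/eqP/negPn/negP => H; apply: nostrict; left.
have BC : B = ~: L.
  apply/setP => v; have : v \notin C by rewrite C0 inE.
  rewrite /C in_setC negbK in_setU in_setC.
  have [vL _|_ /= ->] := boolP (v \in L); last by [].
  by apply/negP => /common_nbrsP/(_ vL); rewrite ie.
exists L; split=> //; split.
- move=> a b aL bL ab; apply/negPn/negP => neab; apply: nostrict; right.
  by exists a, b.
- by rewrite -BC.
- by move=> a b aL bL; apply: common_nbrsP aL; rewrite -/B BC inE.
Qed.

Theorem theorem1p1 (r : nat) : (3 <= r)%N ->
  exists n0 : nat, forall (R : realType) (n : nat) (e : rel 'I_n),
    (n0 <= n)%N -> simple_graph e ->
    ~ is_minor (complete_graph r) e ->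
    spread R e <= Num.sqrt ((4 * (r - 2) * (n - r + 2) + (r - 3) ^ 2)%N%:R : R)
    /\ (spread R e = Num.sqrt ((4 * (r - 2) * (n - r + 2) + (r - 3) ^ 2)%N%:R : R)
        <-> graph_iso e (graph_join (complete_graph (r - 2)) (empty_graph (n - r + 2)))).
Proof.
move=> r3; pose s := (r - 2)%N.
have s0 : (0 < s)%N by rewrite subn_gt0.
have rE : r = s.+2 by rewrite /s; lia.
have [n0 Hn0] := extremal_structure s0.
exists (n0 + (592 * s ^ 9 + s.+2))%N => R n e big sg noK; have [se ie] := sg.
have nbig : (592 * s ^ 9 + s.+2 <= n)%N by apply: leq_trans big; apply: leq_addl.
have big0 : (n0 <= n)%N by apply: leq_trans big; apply: leq_addr.
have nr : (s.+2 <= n)%N by apply: leq_trans nbig; apply: leq_addl.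
have sn : (s <= n)%N by apply: leq_trans nr; rewrite -addn2 leq_addr.
have noC : ~ clique_model e s.+2 by rewrite -rE => /(clique_model_minor sg).
(* Subtraction is truncated, so this identity rests on [r <= n], which [nr] provides. *)
have mE : (n - r + 2 = n - s)%N by rewrite rE; lia.
have r3E : (r - 3 = s.-1)%N by rewrite rE; lia.
have cardE (L : {set 'I_n}) : #|L| = s -> #|~: L| = (n - s)%N.
  by move=> cL; have := cardsC L; rewrite card_ord cL => E; apply: (@addnI s); rewrite E subnKC.
rewrite -/s mE r3E; set sigma := Num.sqrt _.
have sigE : sigma ^+ 2 = 4 * s%:R * (n - s)%N%:R + (s%:R - 1) ^+ 2.
  rewrite sqr_sqrtr // natrD [(_ * (n - s))%:R]natrM [(4 * s)%:R]natrM natrX.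
  by congr (_ + _ ^+ 2); rewrite -subn1 natrB.
have sig0 : 0 < sigma.
  rewrite sqrtr_gt0 ltr0n addn_gt0 !muln_gt0 s0 subn_gt0.
  by rewrite (leq_trans _ nr).
have joinE (L : {set 'I_n}) : is_clique_join e L -> #|L| = s -> spread R e = sigma.
  move=> jL cL; apply: (clique_join_spread sg jL); rewrite ?cL ?(cardE L) //.
    by rewrite leq_subRL // addnC (leq_trans _ nbig) // leq_add2l -addn2 leq_addr.
  exact: ltW.
have extremal : sigma <= spread R e -> exists L, is_clique_join e L /\ #|L| = s.
  apply: (Hn0 R n e sigma big0 sg noC sig0).
  by rewrite sigE [(n - s)%:R]natrB.
split.
  have [/extremal[L [jL cL]]|/ltW//] := leP sigma (spread R e).
  by rewrite (joinE L jL cL) lexx.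
split=> [E|/iso_clique_join[L [jL cL _]]]; last exact: joinE cL.
have [|L [jL cL]] := extremal; first by rewrite E.
exact: clique_join_iso (cardE _ cL).
Qed.
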